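(* Let $n\ge 2$ and let $\mathscr A$ be an orientation of the Coxeter graph $A_{n-1}$. Then the convex hull of $\{M_{\mathscr A}(T) : T\in\mathcal T_{n+2}\}\subset\mathbb R^n$ is a realization of the $(n-1)$-dimensional associahedron $\mathrm{Ass}(A_{n-1})$, i.e. a convex polytope combinatorially equivalent to the associahedron, and all points $M_{\mathscr A}(T)$ have integer coordinates.
   Context: Let $[n]=\{1,\dots,n\}$. The Coxeter graph $A_{n-1}$ is the path with vertices $\tau_1,\dots,\tau_{n-1}$ and edges $\{\tau_i,\tau_{i+1}\}$, $i\in[n-2]$. An orientation $\mathscr A$ is a choice of direction for every edge. An element $i\in\{2,\dots,n-1\}$ is called up if the edge $\{\tau_{i-1},\tau_i\}$ is directed from $\tau_i$ to $\tau_{i-1}$, and down otherwise; $1$ and $n$ are always down. Let $\mathrm{Do}_{\mathscr A}$ and $\mathrm{Up}_{\mathscr A}$ be the sets of down and up elements. Labelled polygon: fix a convex $(n+2)$-gon $P$. Label one vertex $0$; going counterclockwise, label the following vertices by the down elements in increasing order, then the next vertex by $n+1$, then the remaining vertices by the up elements in decreasing order. Vertices are identified with their labels. A triangulation $T$ of $P$ is a set of $n-1$ pairwise non-crossing diagonals; we regard $T$ as the planar graph formed by these diagonals together with the boundary edges of $P$, and write $\{a,b\}\in T$ if $\{a,b\}$ is an edge of this graph. $\mathcal T_{n+2}$ denotes the set of all triangulations of $P$. Coordinates: for $i\in[n]$ and $j\in\{0,\dots,n+1\}$, let $\mu_i(j)$ be the number of edges of the path along the boundary of $P$ connecting $i$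 and $j$ that uses only labels $\le i$ if $j<i$, respectively only labels $\ge i$ if $j\ge i$. For $T\in\mathcal T_{n+2}$ and $i\in[n]$ let $p^T_\ell(i)=\max\{\mu_i(a): 0\le a<i,\ \{a,i\}\in T\}$, $p^T_r(i)=\max\{\mu_i(b): i<b\le n+1,\ \{i,b\}\in T\}$, $\omega_i=p^T_\ell(i)\,p^T_r(i)$, and $x_i=\omega_i$ if $i\in\mathrm{Do}_{\mathscr A}$, $x_i=n+1-\omega_i$ if $i\in\mathrm{Up}_{\mathscr A}$. Set $M_{\mathscr A}(T)=(x_1,\dots,x_n)$. The associahedron $\mathrm{Ass}(A_{n-1})$ is (up to combinatorial equivalence) the $(n-1)$-dimensional simple polytope whose face lattice is isomorphic to the poset of sets of pairwise non-crossing diagonals of an $(n+2)$-gon ordered by reverse inclusion (vertices correspond to triangulations, edges to flips of one diagonal). *)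

(* Defs.v *)
From mathcomp Require Import all_boot all_order all_algebra.
From mathcomp Require Import classical_sets functions cardinality.
From mathcomp Require Import reals convex.

Set Implicit Arguments.
Unset Strict Implicit.
Unset Printing Implicit Defensive.

Import Order.TTheory GRing.Theory Num.Theory.

(* The vertices of a convex N-gon are 'I_N in counterclockwise order; an edge
   of the polygon or a diagonal is the 2-element set of its endpoints. *)

Definition sides (N : nat) : {set {set 'I_N}} :=
  [set [set i; ordS i] | i : 'I_N].

Definition diagonals (N : nat) : {set {set 'I_N}} :=
  [set D : {set 'I_N} | (#|D| == 2) && (D \notin sides N)].

Definition interleaved (N : nat) (D E : {set 'I_N}) : bool :=
  [exists a in D, [exists b in D, [exists c in E, [exists d in E,
    [&& a < c, c < b & b < d]]]]].

(* Two diagonals of a convex polygon meet in their relative interiors iff their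
   endpoints alternate along the boundary. *)
Definition crossing (N : nat) (D E : {set 'I_N}) : bool :=
  interleaved D E || interleaved E D.

Definition noncrossing_sets (N : nat) : {set {set {set 'I_N}}} :=
  [set S : {set {set 'I_N}} | (S \subset diagonals N) &&
    [forall D in S, [forall E in S, ~~ crossing D E]]].

Definition triangulations (N : nat) : {set {set {set 'I_N}}} :=
  [set T in noncrossing_sets N | #|T| == N - 3].

(* The vertex tau_k of A_(n-1) is the ordinal k - 1 of 'I_n.-1. *)
Definition coxeter_A (n : nat) : rel 'I_n.-1 :=
  fun u v => (v == u.+1 :> nat) || (u == v.+1 :> nat).

(* [d u v] means that the edge {u, v} is directed from u to v. *)
Definition orientation (V : Type) (e d : rel V) : Prop :=
  (forall u v, d u v -> e u v) /\ (forall u v, e u v -> d u v (+) d v u).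

Section Labelling.

Variables (n : nat) (A : rel 'I_n.-1).

(* There are vertices u = tau_i and v = tau_(i-1) with an arrow from u to v;
   this forces 2 <= i <= n - 1. *)
Definition up (i : nat) : bool :=
  [exists u : 'I_n.-1, [exists v : 'I_n.-1, [&& u.+1 == i, v.+2 == i & A u v]]].

Definition labels : seq nat :=
  0 :: [seq i <- iota 1 n | ~~ up i] ++ n.+1 :: rev [seq i <- iota 1 n | up i].

Definition vertex (a : nat) : 'I_n.+2 := inord (index a labels).

Definition is_edge (T : {set {set 'I_n.+2}}) (a b : nat) : bool :=
  [set vertex a; vertex b] \in T :|: sides n.+2.

(* [arc labels i j] lists the labels met going counterclockwise from i to j, j
   excluded, so its size is the number of edges of that boundary path. The two
   boundary paths between i and j are [arc labels i j] and [arc labels j i]; for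
   0 < i <= n exactly one of them is admissible (or i = j and the path is
   empty). *)
Definition mu (i j : nat) : nat :=
  let admissible k := if j < i then k <= i else i <= k in
  if all admissible (arc labels i j) then size (arc labels i j)
  else size (arc labels j i).

Definition pl (T : {set {set 'I_n.+2}}) (i : nat) : nat :=
  \max_(0 <= a < i | is_edge T a i) mu i a.

Definition pr (T : {set {set 'I_n.+2}}) (i : nat) : nat :=
  \max_(i.+1 <= b < n.+2 | is_edge T i b) mu i b.

Definition omega (T : {set {set 'I_n.+2}}) (i : nat) : nat := pl T i * pr T i.

Local Open Scope ring_scope.

(* Row index i : 'I_n stands for the label i + 1. *)
Definition M (R : realType) (T : {set {set 'I_n.+2}}) : 'rV[R]_n :=
  \row_(i < n) if up i.+1 then n.+1%:R - (omega T i.+1)%:R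
               else (omega T i.+1)%:R.

End Labelling.

Arguments M {n} A R T.

Local Open Scope classical_set_scope.
Local Open Scope ring_scope.

Section Polytopes.

Variables (R : realType) (m : nat).

Implicit Types S Q F : set 'rV[R]_m.

Definition convex_hull S : set 'rV[R]_m :=
  smallest (@convex_set R 'rV[R]_m) S.

Definition is_polytope Q : Prop :=
  exists2 S, finite_set S & Q = convex_hull S.

(* x0 + V is the affine hull of S. *)
Definition affine_dim S (d : nat) : Prop :=
  exists2 x0, S x0 & exists2 V : {vspace 'rV[R]_m}, \dim V = d &
    (forall x, S x -> x - x0 \in V) /\
    (forall W : {vspace 'rV[R]_m},
       (forall x, S x -> x - x0 \in W) -> (V <= W)%VS).

Definition is_face Q F : Prop :=
  exists (c : 'cV[R]_m) (b : R),
    (forall x, Q x -> (x *m c) 0 0 <= b) /\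
    F = Q `&` [set x | (x *m c) 0 0 = b].

Definition nonempty_faces Q : set (set 'rV[R]_m) :=
  [set F | is_face Q F /\ F !=set0].

End Polytopes.

Definition order_isomorphic (X Y : Type) (P : set X) (leX : X -> X -> Prop)
    (Q : set Y) (leY : Y -> Y -> Prop) : Prop :=
  exists2 f : X -> Y, set_bij P Q f &
    forall x y, P x -> P y -> (leX x y <-> leY (f x) (f y)).

(* The poset of non-crossing sets of diagonals has no element below the
   triangulations, so it is compared with the non-empty faces. *)
Definition realizes_associahedron (R : realType) (m n : nat)
    (Q : set 'rV[R]_m) : Prop :=
  [/\ is_polytope Q,
      affine_dim Q n.-1 &
      order_isomorphic (nonempty_faces Q) (fun F G => F `<=` G)
        [set` noncrossing_sets n.+2] (fun D E => E \subset D)].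

(* Main.v *)
(** Attach to a diagonal [D] of the polygon, with labels [a < b], the set [K] of the
    middle corners of the triangles that can lie below [D] (so [K] is given by [side a b]),
    and let [beta] be the number of boundary edges below [D].

    - If [T] contains [D], the coordinates of [M T] over [K] sum to [beta (beta - 1) / 2]:
      cut the region below [D] into triangles, each of which contributes the middle
      coordinate, and use induction on [beta].  All [M T] have the same total sum.
    - If [T] does not contain [D], then among the edges of [T] crossing [D] there is one
      whose lower triangle has its middle corner outside [K] and whose upper triangle has
      its middle corner in [K].  Flipping it strictly lowers the sum over [K].  Hence the
      sum over [K] is at least [beta (beta - 1) / 2], with equality iff [D] is in [T].

    So every [D] gives an inequality [gap D >= 0] valid on the hull, tight at [M T] iff [D] is
    in [T].  The [n - 1] flips of [T] give vectors [M T' - M T] dual to the gaps of the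
    diagonals of [T]; they are a basis of the sum-zero hyperplane and span the cone of the
    hull at [M T].  A linear form that is maximal at [M T] therefore cuts out the points where
    the gaps of some set of diagonals of [T] vanish, which identifies the nonempty faces with
    the non-crossing sets. *)

Require Import Defs.
From mathcomp Require Import all_boot all_order all_algebra.
From mathcomp Require Import zify ring lra.

Set Implicit Arguments.
Unset Strict Implicit.
Unset Printing Implicit Defensive.

Import Order.TTheory GRing.Theory Num.Theory.
(** * Triangulations of a convex polygon *)

(* [w] lies strictly inside the counterclockwise arc from [u] to [v]. *)
Definition cyc (u w v : nat) : bool :=
  [|| u < w < v, w < v < u | v < u < w].

(* The chords [a b] and [c d] cross. *)
Definition xc (a b c d : nat) : bool :=
  cyc a c b && cyc b d a || cyc a d b && cyc b c a.

Lemma xcC a b c d : xc a b c d = xc a b d c.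
Proof. by rewrite /xc orbC. Qed.

Lemma xcCl a b c d : xc b a c d = xc a b c d.
Proof. by rewrite /xc orbC andbC [X in _ || X]andbC. Qed.

Lemma cycN u w v : u != w -> w != v -> v != u -> cyc v w u = ~~ cyc u w v.
Proof. by rewrite /cyc; lia. Qed.

Lemma cyc_rot u w v : cyc u w v = cyc w v u.
Proof. by rewrite /cyc; lia. Qed.

Lemma cyc_neq u w v : cyc u w v -> [/\ u != w, w != v & v != u].
Proof. by move=> uwv; split; move: uwv; rewrite /cyc; lia. Qed.

Lemma cyc_anti u w v : cyc u w v -> ~~ cyc w u v.
Proof. by rewrite /cyc; lia. Qed.

Lemma cyc_antir u w v : cyc u w v -> cyc u v w = false.
Proof. by rewrite /cyc; lia. Qed.

Lemma xc_sym a b c d : xc a b c d -> xc c d a b.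
Proof.
rewrite /xc; case/orP=> /andP[abc bda]; apply/orP; [right|left];
  by move: abc bda; rewrite /cyc; clear; lia.
Qed.

Lemma xc_irr a b : ~~ xc a b a b.
Proof. by rewrite /xc /cyc; lia. Qed.

(* A chord leaving the quadrilateral [u w v z] through its diagonal [w z]
   without crossing a side does so at the corner [v]. *)
Lemma quadrilateral_corner u v w z c d : cyc u w v -> cyc v z u ->
  cyc w c z -> cyc z d w -> ~~ xc w v c d -> ~~ xc v z c d -> c = v.
Proof.
move=> uwv vzu wcz zdw; rewrite /xc !negb_or => /andP[nc1 _] /andP[nc2 _].
have zwv : cyc w v z by move: uwv vzu; rewrite /cyc; clear; lia.
have vdw : cyc v d w by move: zdw zwv; rewrite /cyc; clear; lia.
have zdv : cyc z d v by move: zdw zwv; rewrite /cyc; clear; lia.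
move: nc1 nc2 wcz zwv; rewrite vdw zdv !andbT /cyc; clear; lia.
Qed.

Lemma fan_corner u w v c d : u < w < v -> cyc w c v -> cyc v d w ->
  ~~ xc u v c d -> ~~ xc u w c d -> d = u.
Proof.
rewrite /xc !negb_or => uwv wcv vdw /andP[nc1 _] /andP[_ nc2].
by move: uwv wcv vdw nc1 nc2; rewrite /cyc; clear; lia.
Qed.

Lemma eq_set2 (T : finType) (a b c d : T) : [set a; b] = [set c; d] ->
  (a = c /\ b = d) \/ (a = d /\ b = c).
Proof.
move=> eq_ab_cd.
have : a \in [set c; d] by rewrite -eq_ab_cd set21.
have : b \in [set c; d] by rewrite -eq_ab_cd set22.
have : c \in [set a; b] by rewrite eq_ab_cd set21.
have : d \in [set a; b] by rewrite eq_ab_cd set22.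
by rewrite !inE; do 4![case/orP=> /eqP ?]; subst; auto.
Qed.

Section PolygonTriangulations.

Variable N : nat.
Hypothesis N_ge3 : 3 <= N.

Implicit Types (u v w z : 'I_N) (S T : {set {set 'I_N}}).

Definition adj (u v : nat) : bool :=
  [|| v == u.+1, u == v.+1, (u == 0) && (v.+1 == N) | (v == 0) && (u.+1 == N)].

Lemma xc_set2l (a b u v : 'I_N) (c d : nat) :
  [set a; b] = [set u; v] -> xc a b c d = xc u v c d.
Proof. by case/eq_set2=> -[-> ->] //; rewrite xcCl. Qed.

Lemma xc_set2r (a b u v : 'I_N) (c d : nat) :
  [set a; b] = [set u; v] -> xc c d a b = xc c d u v.
Proof. by case/eq_set2=> -[-> ->] //; rewrite xcC. Qed.

Lemma side_adj u v : ([set u; v] \in sides N) = adj u v.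
Proof.
have ordSE (i : 'I_N) : ordS i = (if i.+1 == N then 0 else i.+1) :> nat.
  have ltiN := ltn_ord i; rewrite /=; case: eqP => [->|neq]; first by rewrite modnn.
  by rewrite modn_small //; lia.
apply/imsetP/idP => [[i _ /eq_set2]|].
  have := ordSE i; have := ltn_ord i; rewrite /adj.
  by case: eqP => ? ? ? [[-> ->]|[-> ->]]; lia.
have := ltn_ord u; have := ltn_ord v; have := ordSE u; have := ordSE v.
rewrite /adj => sv su ltv ltu adj_uv.
suff [->|->] : v = ordS u \/ u = ordS v; first by exists u.
  by exists v => //; rewrite setUC.
case: eqP sv => sv1 sv; case: eqP su => su1 su.
- by lia.
- case/or4P: adj_uv => Huv; [left|right|right|left]; apply/ord_inj; lia.
- case/or4P: adj_uv => Huv; [left|right|right|left]; apply/ord_inj; lia.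
- case/or4P: adj_uv => Huv; [left|right|right|left]; apply/ord_inj; lia.
Qed.

Definition ed T u v : bool := [set u; v] \in T :|: sides N.

Lemma edC T u v : ed T u v = ed T v u.
Proof. by rewrite /ed setUC. Qed.

Lemma edE T u v : ed T u v = ([set u; v] \in T) || adj u v.
Proof. by rewrite /ed inE side_adj. Qed.

Lemma crossing_xc a b c d :
  crossing [set a; b] [set c; d] = xc (a : 'I_N) (b : 'I_N) (c : 'I_N) (d : 'I_N).
Proof.
have ilI (x y z t : 'I_N) (D E : {set 'I_N}) : x \in D -> y \in D ->
    z \in E -> t \in E -> [&& x < z, z < y & y < t] -> interleaved D E.
  move=> xD yD zE tE lt4.
  by apply/exists_inP; exists x => //; apply/exists_inP; exists y => //;
     apply/exists_inP; exists z => //; apply/exists_inP; exists t.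
apply/idP/idP.
  rewrite /crossing /interleaved /xc /cyc => /orP[] /exists_inP[x xD]
    /exists_inP[y yD] /exists_inP[z zE] /exists_inP[t tE];
  move: xD yD zE tE; rewrite !inE; do 4![case/orP=> /eqP->]; lia.
have ab := set21 a b; have ba := set22 a b.
have cd := set21 c d; have dc := set22 c d.
rewrite /crossing => xabcd; apply/orP.
(* [interleaved] wants the ends of each chord in increasing order, and the chord with the smaller
   first end comes first. *)
have [leab|ltba] := leqP a b; have [lecd|ltdc] := leqP c d.
- have [lt|lt] := leqP a c; [left; apply: (@ilI a b c d)|right; apply: (@ilI c d a b)];
  by rewrite ?inE ?eqxx ?orbT //; move: xabcd; rewrite /xc /cyc; lia.
- have [lt|lt] := leqP a d; [left; apply: (@ilI a b d c)|right; apply: (@ilI d c a b)];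
  by rewrite ?inE ?eqxx ?orbT //; move: xabcd; rewrite /xc /cyc; lia.
- have [lt|lt] := leqP b c; [left; apply: (@ilI b a c d)|right; apply: (@ilI c d b a)];
  by rewrite ?inE ?eqxx ?orbT //; move: xabcd; rewrite /xc /cyc; lia.
- have [lt|lt] := leqP b d; [left; apply: (@ilI b a d c)|right; apply: (@ilI d c b a)];
  by rewrite ?inE ?eqxx ?orbT //; move: xabcd; rewrite /xc /cyc; lia.
Qed.

Lemma polygon_diagonalP D : reflect (exists2 x : 'I_N * 'I_N,
  D = [set x.1; x.2] & (x.1 < x.2) && ~~ adj x.1 x.2) (D \in diagonals N).
Proof.
rewrite inE; apply: (iffP andP) => [[/cards2P[u [v [neq ->]]]]|[[u v] /= -> /andP[lt nadj]]].
  rewrite side_adj => nadj.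
  have [ltuv|ltvu|/val_inj equv] := ltngtP u v; last by rewrite equv eqxx in neq.
    by exists (u, v) => //=; rewrite ltuv.
  by exists (v, u) => /=; [rewrite setUC|rewrite ltvu; move: nadj; rewrite /adj; lia].
by rewrite side_adj cards2 neq_ltn lt.
Qed.

Lemma noncrossing_setsP S : reflect (S \subset diagonals N /\
  (forall a b c d, [set a; b] \in S -> [set c; d] \in S ->
     ~~ xc (a : 'I_N) (b : 'I_N) (c : 'I_N) (d : 'I_N)))
  (S \in noncrossing_sets N).
Proof.
rewrite inE; apply: (iffP andP) => -[subS ncS]; split=> //.
  by move=> a b c d abS cdS; rewrite -crossing_xc (forall_inP (forall_inP ncS _ abS)).
apply/forall_inP => D DS; apply/forall_inP => E ES.
have /polygon_diagonalP[[a b] /= eD _] := subsetP subS _ DS.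
have /polygon_diagonalP[[c d] /= eE _] := subsetP subS _ ES.
by rewrite eD eE crossing_xc ncS -?eD -?eE.
Qed.

(** Maximality in a form that produces edges. Counting edges shows that these sets are exactly the
    triangulations. *)
Definition maximal_nc T : Prop := T \in noncrossing_sets N /\
  forall u v, u != v ->
    (forall w z, [set w; z] \in T -> ~~ xc u v w z) -> ed T u v.

Lemma ed_neq T u v : T \in noncrossing_sets N -> ed T u v -> u != v :> nat.
Proof.
case/noncrossing_setsP=> subT _; rewrite edE => /orP[/(subsetP subT)|].
  by rewrite !inE cards2; case: (u =P v) => // /eqP; rewrite -val_eqE.
by rewrite /adj; have := ltn_ord u; have := ltn_ord v; lia.
Qed.

Lemma ed_nc T a b c d : T \in noncrossing_sets N -> ed T a b -> ed T c d ->
  ~~ xc a b c d.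
Proof.
case/noncrossing_setsP=> _ ncT; rewrite !edE.
have [[lta ltb] [ltc ltd]] := ((ltn_ord a, ltn_ord b), (ltn_ord c, ltn_ord d)).
case/orP=> [abT|adjab]; case/orP=> [cdT|adjcd]; first exact: ncT;
  by move: (adjab) (adjcd) || move: adjab || move: adjcd; rewrite /xc /cyc /adj; lia.
Qed.

Lemma noncrossing_maximal S : S \in noncrossing_sets N ->
  exists2 T, maximal_nc T & S \subset T.
Proof.
move=> ncS.
have [T maxT sST] := @maxset_exists _ (mem (noncrossing_sets N)) S ncS.
exists T => //; split; first exact: maxsetp maxT.
have /noncrossing_setsP[subT ncT] := maxsetp maxT.
move=> u v neq ncuv; rewrite edE; case: (boolP (adj u v)) => [|nadj]; rewrite ?orbT ?orbF //.
(* A chord that crosses nothing and is no side can be added to [T], so it already lies in the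
   inclusion-maximal [T]. *)
suff /(maxsetsup maxT) <- : [set u; v] |: T \in noncrossing_sets N by rewrite ?setU11 ?subsetUr.
apply/noncrossing_setsP; split.
  rewrite subUset subT andbT sub1set inE side_adj nadj cards2 neq //.
move=> a b c d; rewrite !inE => /orP[/eqP ab|abT] /orP[/eqP cd|cdT].
- by rewrite (xc_set2l _ _ ab) (xc_set2r _ _ cd) xc_irr.
- by rewrite (xc_set2l _ _ ab) ncuv.
- by rewrite (xc_set2r _ _ cd); apply: contra (ncuv _ _ abT) => /xc_sym.
- exact: ncT.
Qed.

(** * Triangles on the edges of a maximal non-crossing set, and the number of its diagonals *)

Section Maximal.

Variable T : {set {set 'I_N}}.
Hypothesis maxT : maximal_nc T.

Let ncT : T \in noncrossing_sets N := maxT.1.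

(* Joining [u] to its last neighbour [w] before [v] leaves no room for an edge
   crossing [w v]. *)
Lemma triangle_inside u v : u.+1 < v -> ed T u v ->
  exists w : 'I_N, [/\ u < w < v, ed T u w & ed T w v].
Proof.
move=> lt2 uv; have ltv := ltn_ord v.
have ltu1 : u.+1 < N by lia.
pose P := [pred w : 'I_N | (u < w < v) && ed T u w].
have P1 : P (Ordinal ltu1) by rewrite /= edE /adj /= eqxx orbT; lia.
case: (@arg_maxnP _ (Ordinal ltu1) P val P1) => w /andP[/= ltw uw] maxw.
exists w; split=> //; apply: maxT.2 => [|c d cdT].
  by rewrite -val_eqE /=; lia.
have cd : ed T c d by rewrite edE cdT.
have dc : ed T d c by rewrite edC.
have no_crossing (x y : 'I_N) : ed T x y -> cyc w x v -> cyc v y w -> False.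
  move=> xy wxv vyw.
  have eyu := fan_corner ltw wxv vyw (ed_nc ncT uv xy) (ed_nc ncT uw xy).
  have := maxw x; have -> : u = y by apply/ord_inj.
  by rewrite /= edC xy; move: ltw wxv eyu; rewrite /cyc; clear; lia.
by apply/negP => /orP[] /andP[]; [apply: no_crossing cd|apply: no_crossing dc].
Qed.

(** Among the edges [p q] other than [u v] with [p <= u] and [v <= q], take a shortest one. Its
    inner triangle has [u v] as a side: otherwise a side of that triangle would be a shorter such
    edge or would cross [u v]. *)
Lemma triangle_outside u v : u < v -> v < N.-1 + u -> ed T u v ->
  exists w : 'I_N, [/\ (w < u) || (v < w), ed T u w & ed T w v].
Proof.
move=> ltuv nbase uv; have ltv := ltn_ord v.
have lt0 : 0 < N by lia.
have ltN : N.-1 < N by lia.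
pose P := [pred x : 'I_N * 'I_N | [&& x.1 <= u, v <= x.2, x != (u, v) & ed T x.1 x.2]].
(* The search starts from the side joining [0] and [N - 1]; [nbase] says that [u v] is not this
   side. *)
have P0 : P (Ordinal lt0, Ordinal ltN).
  rewrite /= xpair_eqE -!val_eqE /= edE /adj /=; lia.
case: (@arg_minnP _ _ P (fun x => x.2 - x.1) P0) => -[p q].
rewrite /= xpair_eqE -!val_eqE /= => /and4P[lep leq neq pq] minpq.
have [|w [ltw pw wq]] := triangle_inside _ pq; first by lia.
have nc1 := ed_nc ncT uv pw; have nc2 := ed_nc ncT uv wq.
have [lewu|ltuw] := leqP w u.
  have := minpq (w, q); rewrite /= xpair_eqE -!val_eqE /= wq => min1.
  have equ : u = w by apply/val_inj => /=; lia.
  have eqv : v = q by apply/val_inj => /=; lia.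
  by exists p; split; [lia|rewrite edC equ|rewrite eqv].
have levw : v <= w by move: nc1 nc2; rewrite /xc /cyc; lia.
have := minpq (p, w); rewrite /= xpair_eqE -!val_eqE /= pw => min1.
have equ : u = p by apply/val_inj => /=; lia.
have eqv : v = w by apply/val_inj => /=; lia.
by exists q; split; [lia|rewrite equ|rewrite eqv edC].
Qed.

Lemma triangle_cyc u v : ed T u v -> (exists z : 'I_N, cyc u z v) ->
  exists w : 'I_N, [/\ cyc u w v, ed T u w & ed T w v].
Proof.
move=> uv [z uzv]; have := ed_neq ncT uv; have := ltn_ord z => ltz.
rewrite neq_ltn => /orP[lt|lt].
  have [|w [? ? ?]] := triangle_inside _ uv; first by move: uzv; rewrite /cyc; lia.
  by exists w; split=> //; rewrite /cyc; lia.
have vu : ed T v u by rewrite edC.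
have [||w [? ? ?]] := triangle_outside _ _ vu; [lia| |].
  by have := ltn_ord u; move: uzv; rewrite /cyc; lia.
by exists w; split; rewrite 1?edC //; rewrite /cyc; lia.
Qed.

(** The edge [u v] cuts off a polygon with [k = v - u + 1] corners, whose triangulation has [2k - 3]
    edges. The induction cuts it along the triangle on [u v]. *)
Lemma card_edges_inside u v : u < v -> ed T u v ->
  #|[set x : 'I_N * 'I_N | [&& u <= x.1, x.1 < x.2, x.2 <= v & ed T x.1 x.2]]|
    = (v - u).*2.-1.
Proof.
have [m] := ubnP (v - u); elim: m u v => // m IHm u v ltm ltuv uv.
have [lt2|le2] := ltnP u.+1 v; last first.
  have -> : v - u = 1 by lia.
  rewrite -[RHS](cards1 (u, v)); apply: eq_card => -[x y]; rewrite !inE /= xpair_eqE.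
  apply/idP/idP => [/and4P[? ? ? _]|/andP[/eqP-> /eqP->]]; last by rewrite uv ltuv !leqnn.
  by rewrite -!val_eqE /=; lia.
have [w [/andP[ltuw ltwv] uw wv]] := triangle_inside lt2 uv.
have := IHm u w; have := IHm w v.
set A := [set x | _]; set B := [set x | _]; set C := [set x | _] => IHB IHC.
have disAB : [disjoint B & A].
  by rewrite -setI_eq0; apply/eqP/setP => -[x y]; rewrite !inE /=; lia.
(* An edge straddling [w] would cross [u w] or [w v], unless it is [u v] itself. *)
have -> : C = (u, v) |: (B :|: A).
  apply/setP => -[x y]; rewrite !inE /= xpair_eqE -!val_eqE /=.
  case xy: (ed T x y); last first.
    rewrite !andbF !orbF; apply/esym/negP => /andP[/eqP/val_inj ex /eqP/val_inj ey].
    by rewrite ex ey uv in xy.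
  rewrite !andbT; apply/and3P/idP => [[leux ltxy leyv]|]; last first.
    by case/orP=> [/andP[/eqP ex /eqP ey]|/orP[]/and3P[]*]; split; lia.
  have [leyw|ltwy] := leqP y w; first by rewrite leux ltxy !orbT.
  have [lewx|ltxw] := leqP w x; first by rewrite ltxy leyv !orbT.
  have nc1 := ed_nc ncT xy uw; have nc2 := ed_nc ncT xy wv.
  have -> : x == u :> nat by move: nc1; rewrite /xc /cyc; lia.
  by have -> : y == v :> nat by move: nc2; rewrite /xc /cyc; lia.
rewrite cardsU1 cardsU (eqP (_ : B :&: A == set0)) ?setI_eq0 // cards0 subn0.
rewrite IHB ?IHC //; try lia.
have -> : (u, v) \notin B :|: A by rewrite !inE /=; lia.
by lia.
Qed.

Lemma card_sides : #|sides N| = N.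
Proof.
rewrite card_imset ?card_ord // => i j.
have ordSE (k : 'I_N) : ordS k = (if k.+1 == N then 0 else k.+1) :> nat.
  have := ltn_ord k; rewrite /=; case: eqP => [-> _|neq lt]; first by rewrite modnn.
  by rewrite modn_small //; lia.
case/eq_set2=> [[]//|[ei ej]].
have := congr1 (@nat_of_ord N) ei; have := congr1 (@nat_of_ord N) ej; rewrite !ordSE.
have := ltn_ord i; have := ltn_ord j.
by case: eqP; case: eqP => /= *; lia.
Qed.

(** All edges lie inside the side from [0] to [N - 1], so there are [2N - 3] of them, and [N] are
    sides of the polygon. *)
Lemma card_maximal_nc : #|T| = N - 3.
Proof.
have /noncrossing_setsP[subT _] := ncT.
have lt0 : 0 < N by lia.
have ltN : N.-1 < N by lia.
have e0 : ed T (Ordinal lt0) (Ordinal ltN) by rewrite edE /adj /=; lia.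
have := @card_edges_inside (Ordinal lt0) (Ordinal ltN) _ e0.
set C := [set x | _] => /(_ _)/= cardC.
have : #|T :|: sides N| = #|C|.
  have <- : [set [set x.1; x.2] | x in C] = T :|: sides N.
    apply/setP => D; apply/imsetP/idP => [[[x y]]|DT].
      by rewrite inE /= => /and3P[_ _ xy] ->.
    have [u [v [neq eD]]] : exists u v, u != v /\ D = [set u; v].
      move: DT; rewrite inE => /orP[/(subsetP subT)|/imsetP[i _ ->]].
        by rewrite inE => /andP[/cards2P[u [v [? ?]]] _]; exists u, v.
      exists i, (ordS i); split=> //.
      have := ed_neq ncT (_ : ed T i (ordS i)); rewrite -val_eqE => -> //.
      by rewrite /ed inE; apply/orP; right; apply/imsetP; exists i.
    have uv : ed T u v by rewrite /ed -eD.
    have [ltuv|ltvu|/val_inj eq] := ltngtP u v; last by rewrite eq eqxx in neq.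
      by exists (u, v) => //; rewrite inE /= uv ltuv; have := ltn_ord v; lia.
    exists (v, u); last by rewrite setUC.
    by rewrite inE /= edC uv ltvu; have := ltn_ord u; lia.
  rewrite card_in_imset // => -[x y] [x' y']; rewrite !inE /=.
  move=> /and3P[ltx _ _] /and3P[ltx' _ _] /eq_set2[[-> ->]//|[ex ey]].
  by subst; lia.
rewrite cardC; last by lia.
rewrite cardsU card_sides (_ : T :&: sides N = set0) ?cards0 => [cardE|].
  have count_eq t : t + N - 0 = (N.-1 - 0).*2.-1 -> t = N - 3 by lia.
  exact: count_eq cardE.
apply/setP => D; rewrite !inE; apply/negP => /andP[/(subsetP subT)].
by rewrite inE => /andP[_ /negP].
Qed.

End Maximal.

Lemma maximal_triangulation T : maximal_nc T -> T \in triangulations N.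
Proof. by move=> maxT; rewrite inE card_maximal_nc // eqxx maxT.1. Qed.

(** A maximal extension of [T] has the same number of diagonals, hence equals [T]. *)
Lemma triangulation_maximal T : T \in triangulations N -> maximal_nc T.
Proof.
rewrite inE => /andP[ncT /eqP cardT].
have [T' maxT' subTT'] := noncrossing_maximal ncT.
suff -> : T = T' by [].
by apply/eqP; rewrite eqEcard subTT' cardT (card_maximal_nc maxT') leqnn.
Qed.

Lemma noncrossing_extend S : S \in noncrossing_sets N ->
  exists2 T, T \in triangulations N & S \subset T.
Proof.
by case/noncrossing_maximal=> T /maximal_triangulation triT sST; exists T.
Qed.

Lemma noncrossing_sub S T :
  T \in noncrossing_sets N -> S \subset T -> S \in noncrossing_sets N.
Proof.
case/noncrossing_setsP=> subT nc sST; apply/noncrossing_setsP; split.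
  exact: subset_trans subT.
by move=> a b c d /(subsetP sST) ? /(subsetP sST) ?; apply: nc.
Qed.

(** An edge of [T] that crosses [w z] crosses no side of the quadrilateral [u w v z], so by
    [quadrilateral_corner] its ends are [u] and [v]. *)
Lemma flip_triangulation T u v w z : T \in triangulations N ->
  [set u; v] \in T -> cyc u w v -> cyc v z u ->
  ed T u w -> ed T w v -> ed T v z -> ed T z u ->
  [set w; z] |: (T :\ [set u; v]) \in triangulations N.
Proof.
move=> triT uvT uwv vzu uw wv vz zu.
have ncT : T \in noncrossing_sets N by move: triT; rewrite inE => /andP[].
have /noncrossing_setsP[subT nc] := ncT.
have wzNT : [set w; z] \notin T.
  by apply/negP => /(nc _ _ _ _ uvT); rewrite /xc uwv vzu.
have ltuN := ltn_ord u; have ltvN := ltn_ord v.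
have ltwN := ltn_ord w; have ltzN := ltn_ord z.
have nc_wz c d : [set c; d] \in T :\ [set u; v] -> ~~ xc w z c d.
  rewrite in_setD1 => /andP[neq cdT].
  have cd : ed T c d by rewrite edE cdT.
  have uv : ed T u v by rewrite edE uvT.
  have neq_uv : (c, d) != (v, u).
    by apply: contra neq => /eqP[-> ->]; rewrite setUC.
  have neq_vu : (d, c) != (v, u).
    by apply: contra neq => /eqP[-> ->].
  have corner (x y : 'I_N) : ed T x y -> (x, y) != (v, u) ->
      ~~ (cyc w x z && cyc z y w).
    move=> xy neqxy; apply/negP => /andP[wxz zyw]; case/eqP: neqxy; congr pair.
      exact/val_inj/(quadrilateral_corner uwv vzu wxz zyw (ed_nc ncT wv xy) (ed_nc ncT vz xy)).
    apply/val_inj/(quadrilateral_corner vzu uwv zyw wxz).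
      by rewrite xcC (ed_nc ncT zu xy).
    by rewrite xcC (ed_nc ncT uw xy).
  by rewrite /xc negb_or !corner // edC.
rewrite inE; apply/andP; split; last first.
  move: triT; rewrite inE => /andP[_ /eqP <-].
  by rewrite cardsU1 (cardsD1 [set u; v] T) uvT in_setD1 (negbTE wzNT) andbF.
apply/noncrossing_setsP; split.
  rewrite subUset sub1set (subset_trans (subsetDl _ _) subT) andbT.
  rewrite inE cards2 side_adj /adj; move: uwv vzu.
  by rewrite -val_eqE /cyc /=; lia.
move=> a b c d; rewrite ![_ \in _ |: _]in_setU1.
case/orP=> [/eqP ab|abT]; case/orP=> [/eqP cd|cdT].
- by rewrite (xc_set2l _ _ ab) (xc_set2r _ _ cd) xc_irr.
- by rewrite (xc_set2l _ _ ab) nc_wz.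
- by rewrite (xc_set2r _ _ cd); apply: contra (nc_wz _ _ abT) => /xc_sym.
- by move: abT cdT; rewrite !in_setD1 => /andP[_ ?] /andP[_ ?]; apply: nc.
Qed.

Lemma flip_exists T D : T \in triangulations N -> D \in T ->
  exists2 T', T' \in triangulations N & (T :\ D \subset T') && (D \notin T').
Proof.
move=> triT DT; have maxT := triangulation_maximal triT.
have /noncrossing_setsP[subT _] := maxT.1.
have /polygon_diagonalP[[u v] /= eD /andP[ltuv nadj]] := subsetP subT _ DT; subst D.
have uv : ed T u v by rewrite edE DT.
have vu : ed T v u by rewrite edC.
have ltvN := ltn_ord v.
have ltu1 : u.+1 < N by lia.
have [|w [uwv uw wv]] := triangle_cyc maxT uv.
  by exists (Ordinal ltu1); move: nadj ltuv; rewrite /adj /cyc /=; clear; lia.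
have [|z [vzu vz zu]] := triangle_cyc maxT vu.
  have [eqN|neN] := eqVneq v.+1 N.
    have lt0 : 0 < N by lia.
    by exists (Ordinal lt0); move: nadj ltuv eqN; rewrite /adj /cyc /=; clear; lia.
  have ltv1 : v.+1 < N by lia.
  by exists (Ordinal ltv1); move: nadj ltuv neN ltvN; rewrite /adj /cyc /=; clear; lia.
exists ([set w; z] |: (T :\ [set u; v])); first exact: flip_triangulation.
rewrite subsetUr in_setU1 in_setD1 eqxx orbF.
(* The new diagonal crosses the old one and so differs from it. *)
apply/negP => /eqP eqD; have /negP[] := xc_irr w z.
by rewrite -(xc_set2l w z eqD) /xc uwv vzu.
Qed.

End PolygonTriangulations.
(** * Labels and coordinates *)

Section Labels.

Variables (n : nat) (A : rel 'I_n.-1).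
Hypothesis n_ge2 : 2 <= n.

Local Notation up := (@up n A).
Local Notation labels := (@labels n A).
Local Notation vertex := (@vertex n A).
Local Notation is_edge := (@is_edge n A).
Local Notation N := n.+2.

Implicit Types (T : {set {set 'I_N}}) (i j a b x y : nat).

Let N_ge3 : 3 <= N. Proof. by lia. Qed.

Lemma up_bounds i : up i -> 2 <= i < n.
Proof.
case/existsP=> u /existsP[v /and3P[/eqP <- /eqP eqv _]].
by have := ltn_ord u; lia.
Qed.

Lemma up0 : up 0 = false.
Proof. by case H: (up 0) => //; have := up_bounds H. Qed.

Lemma upN : up n.+1 = false.
Proof. by case H: (up n.+1) => //; have := up_bounds H; lia. Qed.

(* The labels are met counterclockwise in the order of increasing keys. *)
Definition key x : nat := if up x then n.*2 + 4 - x else x.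

Lemma mem_labels x : (x \in labels) = (x < N).
Proof.
rewrite /labels inE mem_cat inE mem_rev !mem_filter mem_iota.
by have := @up_bounds x; case: (up x) => H; lia.
Qed.

Lemma labels_sorted : sorted (fun x y => key x < key y) labels.
Proof.
have key_trans : transitive (fun x y => key x < key y) by move=> x y z; apply: ltn_trans.
rewrite (sorted_pairwise key_trans) /labels /= pairwise_cat /= -!(sorted_pairwise key_trans).
rewrite rev_sorted all_cat /= /key up0 upN.
set dn := [seq i <- _ | ~~ _]; set us := [seq i <- _ | up _].
have dnP x : x \in dn -> ~~ up x /\ 0 < x <= n.
  by rewrite mem_filter mem_iota => /andP[-> ?]; split=> //; lia.
have usP x : x \in us -> up x /\ 0 < x <= n.
  by rewrite mem_filter mem_iota => /andP[-> ?]; split=> //; lia.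
have sort_iota (q : pred nat) : sorted ltn [seq i <- iota 1 n | q i].
  exact: (sorted_filter ltn_trans q (iota_ltn_sorted 1 n)).
apply/and3P; split.
- apply/and3P; split=> //; apply/allP => x; rewrite ?mem_rev.
  + by case/dnP=> /negbTE-> /andP[].
  + by case/usP=> -> ?; lia.
- apply/allrelP => x y /dnP[/negbTE-> ltx]; rewrite inE mem_rev.
  case/orP=> [/eqP->|/usP[upy lty]]; first by rewrite upN; lia.
  by rewrite upy; lia.
- apply/and3P; split.
  + refine (@sub_in_sorted _ (mem dn) ltn _ _ _ _ (sort_iota _)); last exact/allP.
    by move=> x y /dnP[/negbTE-> _] /dnP[/negbTE-> _].
  + by apply/allP => x; rewrite mem_rev => /usP[-> ?]; lia.
  + refine (@sub_in_sorted _ (mem us) ltn _ _ _ _ (sort_iota _)); last exact/allP.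
    by move=> x y /usP[-> ?] /usP[-> ?] /=; lia.
Qed.

Lemma labels_uniq : uniq labels.
Proof.
apply: sorted_uniq labels_sorted; first by move=> x y z; apply: ltn_trans.
by move=> x; rewrite ltnn.
Qed.

Lemma size_labels : size labels = N.
Proof.
have : perm_eq labels (iota 0 N).
  apply: uniq_perm; rewrite ?iota_uniq ?labels_uniq // => x.
  by rewrite mem_labels mem_iota.
by move/perm_size->; rewrite size_iota.
Qed.

Definition pos x : nat := index x labels.

Lemma pos_lt x : x < N -> pos x < N.
Proof. by rewrite -mem_labels -index_mem size_labels. Qed.

Lemma vertexE x : x < N -> vertex x = pos x :> nat.
Proof. by move=> ltx; rewrite inordK // pos_lt. Qed.

Lemma pos_inj x y : x < N -> y < N -> pos x = pos y -> x = y.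
Proof. by rewrite -!mem_labels => ? ?; apply: index_inj. Qed.

Lemma vertex_inj x y : x < N -> y < N -> vertex x = vertex y -> x = y.
Proof. by move=> ltx lty eqxy; apply: pos_inj => //; rewrite -!vertexE // eqxy. Qed.

Lemma vertex_surj (p : 'I_N) : exists2 x, x < N & p = vertex x.
Proof.
exists (nth 0 labels p).
  by rewrite -mem_labels mem_nth // size_labels.
apply/ord_inj; rewrite vertexE -?mem_labels ?mem_nth ?size_labels //.
by rewrite /pos index_uniq ?size_labels // labels_uniq.
Qed.

Lemma pos_key x y : x < N -> y < N -> (pos x < pos y) = (key x < key y).
Proof.
have key_trans : transitive (fun x y => key x < key y) by move=> u v z; apply: ltn_trans.
move=> ltx lty; have [ltp|ltp|/pos_inj ->//] := ltngtP (pos x) (pos y); last by rewrite ltnn.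
  by apply/esym/(sorted_ltn_index key_trans labels_sorted _ _ _ _ ltp); rewrite mem_labels.
apply/esym/negbTE; rewrite -leqNgt ltnW //.
by apply/(sorted_ltn_index key_trans labels_sorted _ _ _ _ ltp); rewrite mem_labels.
Qed.

Lemma cyc_pos x y z : x < N -> y < N -> z < N ->
  cyc (vertex x) (vertex y) (vertex z) = cyc (key x) (key y) (key z).
Proof. by move=> ltx lty ltz; rewrite !vertexE // /cyc !pos_key. Qed.

(* The number of sides on the counterclockwise arc from [x] to [y]. *)
Definition bet x y : nat :=
  if pos x <= pos y then pos y - pos x else N + pos y - pos x.

(** [arc labels i j] is the part of this rotation before [j], so its size and members are read off
    from positions in the rotation. *)
Lemma index_rot_labels i j : i < N -> j < N ->
  index j (rot (pos i) labels) = bet i j.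
Proof.
move=> lti ltj; set s1 := take (pos i) labels; set s2 := drop (pos i) labels.
have sz1 : size s1 = pos i by rewrite size_takel // size_labels ltnW ?pos_lt.
have sz2 : size s2 = N - pos i by rewrite size_drop size_labels.
have js : (j \in s1) || (j \in s2) by rewrite -mem_cat cat_take_drop mem_labels.
have : uniq (s1 ++ s2) by rewrite cat_take_drop labels_uniq.
rewrite cat_uniq => /and3P[_ /hasPn disj _].
have : pos j = index j (s1 ++ s2) by rewrite cat_take_drop.
rewrite /bet /rot -/s1 -/s2 !index_cat sz1 sz2; have := pos_lt lti.
have := index_mem j s1; rewrite sz1.
case: (boolP (j \in s2)) js => [js2 _|_].
  by rewrite (negbTE (disj _ js2)) /= => _ _ ->; rewrite leq_addr addKn.
by rewrite orbF => -> /= ltj1 ltiN ->; rewrite leqNgt ltj1 /= addnBAC // ltnW.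
Qed.

Lemma arc_take i j : i < N -> j < N ->
  arc labels i j = take (bet i j) (rot (pos i) labels).
Proof. by move=> lti ltj; rewrite -(index_rot_labels lti ltj). Qed.

Lemma size_arc i j : i < N -> j < N -> size (arc labels i j) = bet i j.
Proof.
move=> lti ltj; rewrite arc_take // size_takel // -(index_rot_labels lti ltj).
exact: index_size.
Qed.

Lemma mem_arc i j k : i < N -> j < N -> k < N ->
  (k \in arc labels i j) = (bet i k < bet i j).
Proof.
move=> lti ltj ltk; rewrite arc_take // in_take ?mem_rot ?mem_labels //.
by rewrite index_rot_labels.
Qed.

Lemma bet_lt i j k : i < N -> j < N -> k < N -> i != j -> j != k -> i != k ->
  (bet i k < bet i j) = cyc (key i) (key k) (key j).
Proof.
move=> lti ltj ltk ij jk ik.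
have posN x y : x < N -> y < N -> x != y -> pos x != pos y.
  by move=> ltx lty; apply: contra => /eqP/pos_inj->.
have := pos_lt lti; have := pos_lt ltj; have := pos_lt ltk.
have := posN _ _ lti ltj ij; have := posN _ _ ltj ltk jk; have := posN _ _ lti ltk ik.
rewrite /cyc -!pos_key // /bet; clear; do ?case: ifP; lia.
Qed.

(** For [j < i] the admissible path is the one avoiding [n + 1], otherwise the one avoiding [0].
    Counterclockwise from [i], the label [n + 1] comes before [0] if [i] is down, and after it if
    [i] is up. *)
Lemma muE i j : 0 < i <= n -> j < N -> i != j ->
  mu A i j = if (j < i) (+) up i then bet j i else bet i j.
Proof.
move=> lei ltj ij; have lti : i < N by lia.
rewrite /mu !size_arc //; set adm := fun k => _.
have admE : all adm (arc labels i j) = ((j < i) == up i).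
  apply/allP/eqP => [admP|e].
    have P k : k < N -> k != i -> k != j -> cyc (key i) (key k) (key j) -> adm k.
      by move=> ltk ki kj ikj; apply: admP; rewrite mem_arc // bet_lt // eq_sym.
    have := P 0; have := P n.+1; rewrite /adm /cyc /key up0 upN.
    have := @up_bounds i; have := @up_bounds j.
    by case: (ltnP j i) => ?; case: (up i); case: (up j) => //; lia.
  move=> k kij.
  have ltk : k < N by have := mem_take kij; rewrite mem_rot mem_labels.
  move: kij; rewrite mem_arc // /adm.
  have [->|ki] := eqVneq k i; first by case: ifP.
  have [->|kj] := eqVneq k j; first by rewrite ltnn.
  rewrite bet_lt // 1?eq_sym // /cyc /key; move: e.
  have := @up_bounds i; have := @up_bounds j; have := @up_bounds k.
  by case: (ltnP j i) => ?; case: (up i); case: (up j); case: (up k) => //; lia.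
by rewrite admE; case: (j < i); case: (up i).
Qed.

Lemma bet_add a b c : a < N -> b < N -> c < N ->
  cyc (key a) (key b) (key c) -> bet a c = bet a b + bet b c.
Proof.
move=> lta ltb ltc; rewrite /cyc -!pos_key // /bet.
by have := pos_lt lta; have := pos_lt ltb; have := pos_lt ltc; clear; do ?case: ifP; lia.
Qed.

Lemma betC a b : a < N -> b < N -> a != b -> bet a b + bet b a = N.
Proof.
move=> lta ltb neq; have : pos a != pos b by apply: contra neq => /eqP/pos_inj->.
by have := pos_lt lta; have := pos_lt ltb; rewrite /bet; clear; do ?case: ifP; lia.
Qed.

Lemma bet_gt0 a b : a < N -> b < N -> a != b -> 0 < bet a b.
Proof.
move=> lta ltb neq; have : pos a != pos b by apply: contra neq => /eqP/pos_inj->.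
by have := pos_lt lta; have := pos_lt ltb; rewrite /bet; clear; do ?case: ifP; lia.
Qed.

Lemma key_inj x y : x < N -> y < N -> key x = key y -> x = y.
Proof.
by move=> ltx lty; rewrite /key; have := @up_bounds x; have := @up_bounds y;
  case: (up x); case: (up y); lia.
Qed.

Lemma key_neq x y : x < N -> y < N -> x != y -> key x != key y.
Proof. by move=> ltx lty; apply: contra => /eqP/key_inj->. Qed.

Lemma label_sides x i y : x < i -> i < y -> 0 < i <= n -> y < N ->
  if up i then cyc (key i) (key x) (key y) else cyc (key i) (key y) (key x).
Proof.
rewrite /cyc /key; have := @up_bounds x; have := @up_bounds i; have := @up_bounds y.
by clear; case: (up x); case: (up i); case: (up y); lia.
Qed.

(** The next label counterclockwise: the side towards it starts the turns around a corner and is the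
    base of the induction on [bet]. *)
Lemma label_succ a : a < N -> exists s, [/\ s < N, forall T, is_edge T a s,
  bet a s = 1 & forall z, z < N -> ~~ cyc (key a) (key z) (key s)].
Proof.
move=> lta; have [s lts eqs] := vertex_surj (ordS (vertex a)).
have eqpos : pos s = if (pos a).+1 == N then 0 else (pos a).+1.
  rewrite -vertexE // -eqs /= vertexE //; have := pos_lt lta.
  by case: eqP => [-> _|neq lt]; rewrite ?modnn // modn_small //; move: neq lt; clear; lia.
have ltpa := pos_lt lta; exists s; split=> // [T||z ltz].
- by rewrite /is_edge -eqs inE; apply/orP; right; apply/imsetP; exists (vertex a).
- by rewrite /bet eqpos; case: eqP => [|_]; move: ltpa; clear; case: ifP; lia.
rewrite /cyc -!pos_key // eqpos; have := pos_lt ltz; move: ltpa.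
by clear; case: eqP; lia.
Qed.

(** * Edges, triangles and coordinates in terms of labels *)

Section Edges.

Variable T : {set {set 'I_N}}.
Hypothesis triT : T \in triangulations N.

Let maxT := triangulation_maximal N_ge3 triT.

Lemma edgeC a b : is_edge T a b = is_edge T b a.
Proof. by rewrite /is_edge setUC. Qed.

Lemma edge_neq a b : is_edge T a b -> a != b.
Proof.
by move=> ab; apply/eqP => eqab; have := ed_neq N_ge3 maxT.1 ab; rewrite eqab eqxx.
Qed.

Lemma edge_nc a b c d : a < N -> b < N -> c < N -> d < N ->
  is_edge T a b -> is_edge T c d ->
  ~~ (cyc (key a) (key c) (key b) && cyc (key b) (key d) (key a)).
Proof.
move=> lta ltb ltc ltd ab cd; have := ed_nc N_ge3 maxT.1 ab cd.
by rewrite /xc negb_or !cyc_pos // => /andP[].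
Qed.

Lemma edge_triangle a b z : a < N -> b < N -> z < N -> is_edge T a b ->
  cyc (key a) (key z) (key b) ->
  exists w, [/\ w < N, cyc (key a) (key w) (key b), is_edge T a w & is_edge T w b].
Proof.
move=> lta ltb ltz ab azb.
have [|p [apb ap pb]] := triangle_cyc N_ge3 maxT ab; first by exists (vertex z); rewrite cyc_pos.
have [w ltw eqp] := vertex_surj p; exists w.
split=> //; first by rewrite -cyc_pos // -eqp.
  by rewrite /is_edge -eqp.
by rewrite /is_edge -eqp.
Qed.

Lemma edge_adj a b : a < N -> b < N -> is_edge T a b ->
  (exists z, z < N /\ cyc (key a) (key z) (key b)) -> 
  (exists z, z < N /\ cyc (key b) (key z) (key a)) -> [set vertex a; vertex b] \in T.
Proof.
move=> lta ltb + [z [ltz azb]] [w [ltw bwa]].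
rewrite /is_edge -[_ \in _]/(ed T (vertex a) (vertex b)) edE // => /orP[//|].
move: azb bwa; rewrite -!cyc_pos // /adj /cyc.
have := ltn_ord (vertex a); have := ltn_ord (vertex b).
have := ltn_ord (vertex z); have := ltn_ord (vertex w); clear; lia.
Qed.

(* Turning around [v] from an edge whose end satisfies [P], the last edge of
   this kind bounds a triangle whose third corner fails [P]. *)
Lemma edge_fan (P : pred nat) v l : v < N -> l < N -> is_edge T v l -> P l ->
  (forall x, x < N -> is_edge T v x -> P x ->
     exists z, z < N /\ cyc (key x) (key z) (key v)) ->
  exists x y, [/\ x < N, y < N, P x, ~~ P y & [/\ cyc (key x) (key y) (key v),
    is_edge T v x, is_edge T v y & is_edge T x y]].
Proof.
move=> ltv + + + room; have [m] := ubnP (bet l v); elim: m l => // m IHm l ltm ltl vl Pl.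
have [z [ltz lzv]] := room _ ltl vl Pl.
have lv : is_edge T l v by rewrite edgeC.
have [w [ltw lwv lw wv]] := edge_triangle ltl ltv ltz lv lzv.
have vw : is_edge T v w by rewrite edgeC.
have [Pw|nPw] := boolP (P w); last by exists l, w.
apply: (IHm w) => //.
rewrite (bet_add ltl ltw ltv lwv) in ltm.
by have := bet_gt0 ltl ltw (edge_neq lw); move: ltm; clear; lia.
Qed.

(** Turn around [i] from the next label, which is smaller than [i] exactly when [i] is up. Where the
    neighbours first change between smaller and larger labels, the triangle has [i] as its middle
    corner. *)
Lemma triangle_at i : 0 < i <= n -> exists a b, [/\ a < i < b, b < N &
  [/\ is_edge T a i, is_edge T i b & is_edge T a b]].
Proof.
move=> lei; have lti : i < N by lia.
have [s [lts /(_ T) si _ succ_s]] := label_succ lti.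
have neqs := edge_neq si.
have [||x [y [ltx lty Px Py [xyi ix iy xy]]]] :=
  @edge_fan (fun x => (x < i) == up i) i s lti lts si.
- have := succ_s 0; have := succ_s n.+1; rewrite /cyc /key up0 upN.
  have := @up_bounds i; have := @up_bounds s; move: neqs lts; clear -lei.
  by case: (ltnP s i) => ?; case: (up i); case: (up s) => //; lia.
- move=> x ltx /edge_neq neqx; case upi: (up i) => /eqP ltxi; [exists n.+1|exists 0]; split=> //;
  rewrite /cyc /key upi ?up0 ?upN; have := @up_bounds x; have := @up_bounds i;
  by case: (up x); rewrite ?upi; lia.
have neqx := edge_neq ix; have neqy := edge_neq iy.
by case: (up i) Px Py => Px Py; [exists x, y|exists y, x]; split; rewrite 1?edgeC //; try lia;
  split; rewrite // edgeC.
Qed.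

Definition coordz i : int := (if up i then n.+1%:Z - (omega A T i)%:Z else (omega A T i)%:Z)%R.

Lemma edge_nc_fan i c x y : i < N -> c < N -> x < N -> y < N ->
  is_edge T i c -> is_edge T x y -> cyc (key i) (key x) (key c) ->
  ~~ cyc (key i) (key c) (key y).
Proof.
move=> lti ltc ltx lty ic xy ixc; rewrite cyc_rot.
by have := edge_nc lti ltc ltx lty ic xy; rewrite ixc.
Qed.

(** No neighbour of [i] lies beyond the edge [a b]. So [a] is the farthest smaller neighbour and [b]
    the farthest larger one, and both maxima are attained there. *)
Lemma triangle_coord a i b : a < i < b -> b < N ->
  is_edge T a i -> is_edge T i b -> is_edge T a b ->
  coordz i = (if up i then n.+1%:Z - (bet i a * bet b i)%:Z
              else (bet a i * bet i b)%:Z)%R.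
Proof.
move=> /andP[ltai ltib] ltb ai ib ab.
have lei : 0 < i <= n by lia.
have [lta lti] : a < N /\ i < N by lia.
have ba : is_edge T b a by rewrite edgeC.
have near_le c x y : c < N -> x < N -> y < N -> i != c -> i != x -> x != c ->
    is_edge T i c -> is_edge T x y -> cyc (key i) (key c) (key y) -> bet i c <= bet i x.
  move=> ltc ltx lty ic ix xc eic exy icy; rewrite leqNgt bet_lt // 1?eq_sym //.
  by apply/negP => /(edge_nc_fan lti ltc ltx lty eic exy)/negP.
have far_ge c x y : c < N -> x < N -> y < N -> i != c -> i != x -> x != c ->
    is_edge T i c -> is_edge T x y -> cyc (key i) (key y) (key c) -> bet c i <= bet x i.
  move=> ltc ltx lty ic ix xc eic exy iyc.
  suff : bet i x <= bet i c.
    by have := betC lti ltc ic; have := betC lti ltx ix; clear; lia.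
  rewrite leqNgt bet_lt //; apply/negP => icx.
  by have /negP := edge_nc_fan lti ltc lty ltx eic (etrans (edgeC y x) exy) iyc.
have plE : pl A T i = mu A i a.
  apply/eqP; rewrite eqn_leq /pl; apply/andP; split; last first.
    by apply: leq_bigmax_seq; rewrite ?mem_index_iota ?leq0n.
  apply/bigmax_leqP_seq => c; rewrite mem_index_iota => /andP[_ ltci] ci.
  have ltc : c < N by lia.
  have ic : is_edge T i c by rewrite edgeC.
  have [->//|neqca] := eqVneq c a.
  have [neqic neqia] : i != c /\ i != a by lia.
  rewrite !muE // ltci ltai /=.
  have := label_sides ltci ltib lei ltb; case: (up i) => /= cyc_icb.
    by apply: (near_le c a b); rewrite // eq_sym.
  by apply: (far_ge c a b); rewrite // eq_sym.
have prE : pr A T i = mu A i b.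
  apply/eqP; rewrite eqn_leq /pr; apply/andP; split; last first.
    by apply: leq_bigmax_seq; rewrite ?mem_index_iota ?ltib.
  apply/bigmax_leqP_seq => c; rewrite mem_index_iota => /andP[ltic ltc] ic.
  have [->//|neqcb] := eqVneq c b.
  have [neqic neqib] : i != c /\ i != b by lia.
  rewrite !muE // !ltnNge (ltnW ltic) (ltnW ltib) /=.
  have := label_sides ltai ltic lei ltc; case: (up i) => /= cyc_iac.
    by apply: (far_ge c b a); rewrite // eq_sym.
  by apply: (near_le c b a); rewrite // eq_sym.
have [neqia neqib] : i != a /\ i != b by lia.
by rewrite /coordz /omega plE prE !muE // ltai ltnNge (ltnW ltib) /=; case: (up i).
Qed.

End Edges.
(** * Sums of coordinates on one side of an edge *)

(* The labels of the middle corners of the triangles lying on the side of the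
   edge [a b] met counterclockwise from [a] to [b]; an end of the edge is one of
   them when it is not extremal on that side. *)
Definition side a b i : bool :=
  if (i == a) || (i == b) then (a < b) == up i
  else cyc (key a) (key i) (key b).

(** The median of the three labels. *)
Definition middle a b c : nat :=
  if a < b then (if b < c then b else if a < c then c else a)
  else (if a < c then a else if b < c then c else b).

(** This trades [up] for cyclic order: any smaller and any larger label together reveal whether [i]
    is up. *)
Lemma up_between x i y : x < i -> i < y -> y < N ->
  up i = cyc (key i) (key x) (key y).
Proof.
move=> ltx lty ltyN; have lei : 0 < i <= n by lia.
have := label_sides ltx lty lei ltyN; case: (up i) => //.
by move/cyc_antir->.
Qed.

Lemma side_end_l a b : side a b a = ((a < b) == up a).
Proof. by rewrite /side eqxx. Qed.

Lemma side_end_r a b : side a b b = ((a < b) == up b).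
Proof. by rewrite /side eqxx orbT. Qed.

Lemma side_inner a b i : i != a -> i != b -> side a b i = cyc (key a) (key i) (key b).
Proof. by rewrite /side => /negbTE-> /negbTE->. Qed.

Lemma cyc_key_neq u w v : cyc (key u) (key w) (key v) -> [/\ u != w, w != v & v != u].
Proof.
by case/cyc_neq=> uw wv vu; split; [move: uw|move: wv|move: vu]; apply: contra => /eqP->.
Qed.

Lemma middle_bounds u w v : u < N -> w < N -> v < N ->
  u != w -> w != v -> v != u -> 0 < middle u w v <= n.
Proof. by rewrite /middle => *; do ?case: ifP => *; lia. Qed.

Lemma middle_up x y z : z < N -> cyc (key x) (key y) (key z) ->
  y < x < z -> up x.
Proof. by move=> ltz xyz /andP[yx xz]; rewrite (up_between yx xz). Qed.

Lemma middle_down x y z : y < N -> cyc (key x) (key y) (key z) ->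
  z < x < y -> up x = false.
Proof.
move=> lty xyz /andP[zx xy]; rewrite (up_between zx xy) //.
by apply/negbTE; rewrite cyc_rot; apply: cyc_anti; rewrite -cyc_rot.
Qed.

Lemma cyc_keyN u w v : u < N -> w < N -> v < N -> u != w -> w != v -> v != u ->
  cyc (key v) (key w) (key u) = ~~ cyc (key u) (key w) (key v).
Proof.
move=> ltu ltw ltv uw wv vu; apply: cycN; [move: uw|move: wv|move: vu];
  by apply: contra => /eqP/key_inj->.
Qed.

Lemma up_lt u v : 0 < u -> u < v -> v < N -> up u = cyc (key u) (key 0) (key v).
Proof. exact: up_between. Qed.

Lemma up_gt u v : u <= n -> v < u -> up u = ~~ cyc (key u) (key n.+1) (key v).
Proof.
move=> leu ltvu; rewrite (up_between ltvu (leu : u < n.+1)) //.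
by rewrite cyc_rot; apply: cyc_keyN; lia.
Qed.

(** The triangle [u w v] splits the region cut off by [u v] and contributes its own middle corner.
    Away from the corners this concatenates two arcs; at a corner, [middle_up] and [middle_down]
    settle the count. *)
Lemma side_split u w v i : u < N -> w < N -> v < N -> i < N ->
  cyc (key u) (key w) (key v) ->
  side u v i = side u w i + (i == middle u w v) + side w v i :> nat.
Proof.
move=> ltu ltw ltv lti uwv; have [neuw newv nevu] := cyc_key_neq uwv.
have wvu : cyc (key w) (key v) (key u) by rewrite -cyc_rot.
have vuw : cyc (key v) (key u) (key w) by rewrite -cyc_rot.
have [eu|neu] := eqVneq i u.
  rewrite eu !side_end_l side_inner // 1?eq_sym // (negbTE (cyc_anti uwv)) addn0.
  have := middle_up ltv uwv; have := middle_down ltw uwv.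
  rewrite /middle; move: neuw newv nevu; clear.
  by case: (ltnP u v) => ?; case: (ltnP u w) => ?; case: (ltnP w v) => ?; case: (up u); lia.
have [ev|nev] := eqVneq i v.
  rewrite ev !side_end_r (side_inner (a := u) (b := w)) // 1?eq_sym //.
  rewrite [cyc _ _ _]cyc_rot (negbTE (cyc_anti wvu)).
  have := middle_up ltw vuw; have := middle_down ltu vuw.
  rewrite /middle; move: neuw newv nevu; clear.
  by case: (ltnP u v) => ?; case: (ltnP u w) => ?; case: (ltnP w v) => ?; case: (up v); lia.
have [ew|new] := eqVneq i w.
  rewrite ew side_end_r side_end_l (side_inner (a := u) (b := v)) // 1?eq_sym // uwv.
  have := middle_up ltu wvu; have := middle_down ltv wvu.
  rewrite /middle; move: neuw newv nevu; clear.
  by case: (ltnP u v) => ?; case: (ltnP u w) => ?; case: (ltnP w v) => ?; case: (up w); lia.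
rewrite !side_inner //.
have -> : (i == middle u w v) = false.
  by rewrite /middle; do ?case: ifP => _; apply/negbTE.
have := key_neq lti ltu neu; have := key_neq lti ltw new; have := key_neq lti ltv nev.
move: uwv; rewrite addn0 /cyc; clear.
by move: (key u) (key w) (key v) (key i) => ku kw kv ki; lia.
Qed.
Local Open Scope ring_scope.

(* Twice the sum of the coordinates on that side, for an edge of the triangulation. *)
Definition side_value u v : int :=
  let b := (bet u v)%:Z in
  if (u < v)%N then b * (b - 1)
  else n%:Z * (n%:Z + 1) - (n%:Z + 2 - b) * (n%:Z + 1 - b).

Definition side_sum (f : nat -> int) u v : int :=
  \sum_(i < n) f i.+1 *+ side u v i.+1.

Lemma sum_pick (f : nat -> int) m : (0 < m <= n)%N ->
  \sum_(i < n) f i.+1 *+ (i.+1 == m) = f m.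
Proof.
move=> lem; have ltm : (m.-1 < n)%N by lia.
rewrite (bigD1 (Ordinal ltm)) //= prednK; last by lia.
rewrite eqxx big1 ?addr0 // => i; rewrite -val_eqE /= => neq.
by have -> : (i.+1 == m) = false by lia.
Qed.

Lemma side_sum_split f u w v : (u < N)%N -> (w < N)%N -> (v < N)%N ->
  cyc (key u) (key w) (key v) ->
  side_sum f u v = side_sum f u w + f (middle u w v) + side_sum f w v.
Proof.
move=> ltu ltw ltv uwv; have [neuw newv nevu] := cyc_key_neq uwv.
rewrite -(sum_pick f (middle_bounds ltu ltw ltv neuw newv nevu)) /side_sum.
rewrite -!big_split /=; apply: eq_bigr => i _; have lti := ltn_ord i.
by rewrite -!mulrnDr -side_split //; lia.
Qed.

Lemma sideC u v i : (u < N)%N -> (v < N)%N -> (i < N)%N -> u != v ->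
  side v u i = ~~ side u v i.
Proof.
move=> ltu ltv lti neq; have [eu|neu] := eqVneq i u.
  by rewrite eu side_end_l side_end_r; case: (ltngtP u v) neq; case: (up u).
have [ev|nev] := eqVneq i v.
  by rewrite ev side_end_l side_end_r; case: (ltngtP u v) neq; case: (up v).
by rewrite !side_inner // cycN ?key_neq // eq_sym.
Qed.

Lemma middle_rot a b c : a != b -> b != c -> c != a -> middle a b c = middle b c a.
Proof. by rewrite /middle => *; do ?case: ifP => *; lia. Qed.

Lemma cyc_quad u w v z : cyc u w v -> cyc v z u -> cyc w v z && cyc z u w.
Proof. by move=> uwv vzu; apply/andP; split; move: uwv vzu; rewrite /cyc; clear; lia. Qed.

Lemma side_middle u w v : (u < N)%N -> (w < N)%N -> (v < N)%N ->
  cyc (key u) (key w) (key v) -> side u v (middle u w v).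
Proof.
move=> ltu ltw ltv uwv; have [neuw newv nevu] := cyc_key_neq uwv.
have lem := middle_bounds ltu ltw ltv neuw newv nevu.
have ltm : (middle u w v < N)%N by move: lem; clear; lia.
have := side_split ltu ltw ltv ltm uwv; rewrite eqxx.
by case: (side u v _) => //; lia.
Qed.

Section Flux.

Variable T : {set {set 'I_N}}.
Hypothesis triT : T \in triangulations N.

Local Notation edge := (is_edge T).
Local Notation x := (coordz T).

(** The three arcs cut off by the triangle add up to [n + 2], and the coordinate is the product of
    two of them, or [n + 1] minus it. For each order of the labels the claim is a polynomial
    identity in the arcs. *)
Lemma middle_coord u w v : (u < N)%N -> (w < N)%N -> (v < N)%N ->
  edge u w -> edge w v -> edge u v -> cyc (key u) (key w) (key v) ->
  x (middle u w v) *+ 2 = side_value u v - side_value u w - side_value w v.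
Proof.
move=> ltu ltw ltv uw wv uv uwv; have [neuw newv nevu] := cyc_key_neq uwv.
have wu : edge w u by rewrite edgeC.
have vw : edge v w by rewrite edgeC.
have vu : edge v u by rewrite edgeC.
have wvu : cyc (key w) (key v) (key u) by rewrite -cyc_rot.
have vuw : cyc (key v) (key u) (key w) by rewrite -cyc_rot.
have addb := bet_add ltu ltw ltv uwv; have sumb := betC ltv ltu nevu.
have bwu : bet w u = (bet w v + bet v u)%N.
  by have := betC ltu ltw neuw; move: addb sumb; clear; lia.
have bvw : bet v w = (bet v u + bet u w)%N.
  by have := betC ltw ltv newv; move: addb sumb; clear; lia.
have nE : n%:Z = (bet u w)%:Z + (bet w v)%:Z + (bet v u)%:Z - 2.
  by move: addb sumb; clear; lia.
have fin := (bwu, bvw, addb, nE, PoszD, PoszM, intS).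
move: (triangle_coord triT) => xE.
rewrite /middle /side_value.
case: (ltngtP u w) neuw => // [u_w|w_u] _; case: (ltngtP w v) newv => // [w_v|v_w] _;
  case: (ltngtP v u) nevu => // [v_u|u_v] _.
(* Two of the eight sign patterns are cyclic and contradictory; the six orders of the corners
   remain. *)
all: try by (have := ltn_trans u_w w_v; rewrite ltnNge (ltnW v_u)).
all: try by (have := ltn_trans v_w w_u; rewrite ltnNge (ltnW u_v)).
- by rewrite (xE u w v) ?u_w ?w_v // (middle_down ltv wvu) ?u_w ?w_v // !fin; ring.
- by rewrite (xE v u w) ?v_u ?u_w // (middle_down ltw uwv) ?v_u ?u_w // !fin; ring.
- by rewrite (xE u v w) ?u_v ?v_w // (middle_up ltw vuw) ?u_v ?v_w // !fin; ring.
- by rewrite (xE w v u) ?w_v ?v_u // (middle_down ltu vuw) ?w_v ?v_u // !fin; ring.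
- by rewrite (xE w u v) ?w_u ?u_v // (middle_up ltv uwv) ?w_u ?u_v // !fin; ring.
- by rewrite (xE v w u) ?v_w ?w_u // (middle_up ltu wvu) ?v_w ?w_u // !fin; ring.
Qed.

(** Cutting along the triangle on [u v], the values telescope by [middle_coord]; a side of the
    polygon has no labels and value [0]. For [v < u] the value is the total [n (n + 1)] minus that
    of the reversed edge, whose arc is [n + 2 - b]. *)
Lemma side_sum_edge u v : (u < N)%N -> (v < N)%N -> edge u v ->
  side_sum x u v *+ 2 = side_value u v.
Proof.
have [m] := ubnP (bet u v); elim: m u v => // m IHm u v ltm ltu ltv uv.
have [s [lts /(_ T) us bet_us succ_s]] := label_succ ltu.
have neuv := edge_neq triT uv; have neus := edge_neq triT us.
have [evs|nevs] := eqVneq v s; last first.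
  have usv : cyc (key u) (key s) (key v).
    rewrite -[cyc _ _ _]negbK -cycN ?key_neq // 1?eq_sym // -cyc_rot succ_s //.
  have [w [ltw uwv uw wv]] := edge_triangle triT ltu ltv lts uv usv.
  have addb := bet_add ltu ltw ltv uwv.
  have b1 := bet_gt0 ltu ltw (edge_neq triT uw).
  have b2 := bet_gt0 ltw ltv (edge_neq triT wv).
  rewrite (side_sum_split _ ltu ltw ltv uwv) !mulrnDl (middle_coord ltu ltw ltv) //.
  have -> : side_sum x u w *+ 2 = side_value u w.
    by apply: IHm => //; move: addb b1 b2 ltm; clear; lia.
  have -> : side_sum x w v *+ 2 = side_value w v.
    by apply: IHm => //; move: addb b1 b2 ltm; clear; lia.
  by ring.
have no_side i : (0 < i <= n)%N -> side u v i = false.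
  move=> lei; have lti : (i < N)%N by lia.
  have no0 : ~~ cyc (key u) (key 0) (key v) by rewrite evs succ_s.
  have noN : ~~ cyc (key u) (key n.+1) (key v) by rewrite evs succ_s.
  have [eu|neu] := eqVneq i u; last have [ev|nev] := eqVneq i v.
  - rewrite eu side_end_l; subst i; case/andP: lei => lt0u leu.
    case: (ltngtP u v) neuv => // ltuv _; first by rewrite (up_lt lt0u ltuv ltv) (negbTE no0).
    by rewrite (up_gt leu ltuv) noN.
  - rewrite ev side_end_r; subst i; case/andP: lei => lt0v lev.
    have {}lev : (v < n.+1)%N := lev.
    case: (ltngtP u v) neuv => // ltuv _.
      rewrite (up_gt lev ltuv) cyc_keyN ?noN //; move: ltuv lev; clear; lia.
    rewrite (up_lt lt0v ltuv ltu) cyc_keyN ?no0 //; move: ltuv lt0v; clear; lia.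
  by rewrite side_inner // evs (negbTE (succ_s _ _)).
rewrite /side_sum big1 => [|i _]; last by rewrite no_side //; have := ltn_ord i; lia.
by rewrite /side_value evs bet_us; case: ifP => _; ring.
Qed.

(** The label sets on the two sides of an edge are complementary; here the edge is the side from [0]
    to the next label. *)
Lemma coord_total : (\sum_(i < n) x i.+1) *+ 2 = n%:Z * (n%:Z + 1).
Proof.
have lt0 : (0 < N)%N by [].
have [s [lts /(_ T) e0s _ _]] := label_succ lt0.
have es0 : edge s 0 by rewrite edgeC.
have ne0s := edge_neq triT e0s.
have -> : \sum_(i < n) x i.+1 = side_sum x 0 s + side_sum x s 0.
  rewrite /side_sum -big_split /=; apply: eq_bigr => i _.
  rewrite -mulrnDr (sideC (u := 0%N) (v := s)) //; last by have := ltn_ord i; lia.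
  by case: (side _ _ _).
rewrite mulrnDl !side_sum_edge // /side_value /=.
have ltsz : (0 < s)%N by rewrite lt0n eq_sym.
rewrite ltsz; have sumb := betC lt0 lts ne0s.
have -> : (bet s 0)%:Z = n%:Z + 2 - (bet 0 s)%:Z by move: sumb; clear; lia.
by ring.
Qed.
(** * Flips *)

Section Flip.

Variables a b w z : nat.
Hypotheses (ltab : (a < b)%N) (ltb : (b < N)%N) (ltw : (w < N)%N) (ltz : (z < N)%N).
Hypotheses (awb : cyc (key a) (key w) (key b)) (bza : cyc (key b) (key z) (key a)).
Hypotheses (ab : edge a b) (aw : edge a w) (wb : edge w b) (bz : edge b z) (za : edge z a).

Definition flip : {set {set 'I_N}} :=
  [set vertex w; vertex z] |: (T :\ [set vertex a; vertex b]).

Let lta : (a < N)%N. Proof. exact: ltn_trans ltab ltb. Qed.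

Lemma flip_diagonal : [set vertex a; vertex b] \in T.
Proof. by apply: (@edge_adj T) => //; [exists w|exists z]. Qed.

Lemma flip_triangulation_label : flip \in triangulations N.
Proof.
apply: (flip_triangulation N_ge3 triT flip_diagonal); rewrite ?cyc_pos //.
Qed.

Lemma flip_edge p q : (p < N)%N -> (q < N)%N -> edge p q ->
  (p, q) != (a, b) -> (p, q) != (b, a) -> is_edge flip p q.
Proof.
move=> ltp ltq; rewrite /is_edge /flip !in_setU in_set1 in_setD1.
case/orP=> [pq neq1 neq2|->]; last by rewrite !orbT.
rewrite pq andbT; have [eqv|_] := eqVneq [set vertex p; vertex q] [set vertex a; vertex b].
  case/eq_set2: eqv => -[ep eq]; [case/eqP: neq1|case/eqP: neq2];
  by congr pair; apply: vertex_inj.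
by rewrite orbT.
Qed.

Lemma flip_new_edge : is_edge flip w z.
Proof. by rewrite /is_edge /flip !in_setU in_set1 eqxx. Qed.

(** For another corner [c] on the side of [w], the edge [c b] would cross [a w] or [c a] would cross
    [w b]; likewise on the side of [z]. *)
Lemma flip_third c : (c < N)%N -> edge a c -> edge c b -> c = w \/ c = z.
Proof.
move=> ltc ac cb; have neac := edge_neq triT ac; have necb := edge_neq triT cb.
have [|necw] := eqVneq c w; first by left.
have [|necz] := eqVneq c z; first by right.
have ca : edge c a by rewrite edgeC.
have := edge_nc triT lta ltw ltc ltb aw cb; have := edge_nc triT ltw ltb ltc lta wb ca.
have := edge_nc triT ltb ltz ltc lta bz ca; have := edge_nc triT ltz lta ltc ltb za cb.
have := key_neq lta ltc neac; have := key_neq ltc ltb necb.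
have := key_neq ltc ltw necw; have := key_neq ltc ltz necz.
move: awb bza; move: (key a) (key b) (key c) (key w) (key z) => ka kb kc kw kz; clear.
move=> awb bza cz cw cb ac.
have [|acb] := boolP (cyc ka kc kb).
  move=> acb _ _ n1 n2; exfalso.
  by move: acb awb cw n1 n2; rewrite /cyc; clear; lia.
have bca : cyc kb kc ka by move: acb ac cb awb; rewrite /cyc; clear; lia.
move=> n1 n2 _ _; exfalso.
by move: bca bza cz n1 n2; rewrite /cyc; clear; lia.
Qed.

(** The triangle of [T] with middle corner [i] is neither of the two on [a b], so it survives the
    flip and still determines the coordinate. *)
Lemma flip_coord_other i : (0 < i <= n)%N -> i != middle a w b -> i != middle b z a ->
  coordz flip i = x i.
Proof.
move=> lei neqj neqk; have [p [q [/andP[ltpi ltiq] ltq [pi iq pq]]]] := triangle_at triT lei.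
have lti : (i < N)%N by move: lei; clear; lia.
have ltp : (p < N)%N by move: lei ltpi; clear; lia.
have ltpq := ltn_trans ltpi ltiq.
suff [n1 [n2 n3]] : (p, i) != (a, b) /\ (i, q) != (a, b) /\ (p, q) != (a, b).
  have pibF : (p, i) != (b, a) by apply/eqP => -[? ?]; move: ltab ltpi; subst; clear; lia.
  have iqF : (i, q) != (b, a) by apply/eqP => -[? ?]; move: ltab ltiq; subst; clear; lia.
  have pqF : (p, q) != (b, a) by apply/eqP => -[? ?]; move: ltab ltpq; subst; clear; lia.
  rewrite (triangle_coord flip_triangulation_label (a := p) (b := q)) ?flip_edge ?ltpi //.
  by rewrite (triangle_coord triT (a := p) (b := q)) ?ltpi.
have ltba : (b < a)%N = false by rewrite ltnNge (ltnW ltab).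
move: neqj neqk; rewrite /middle ltab ltba => neqj neqk.
split; [|split]; apply/eqP => -[? ?]; subst.
- have qb : edge q b by rewrite edgeC.
  by case: (flip_third ltq pq qb) => ?; subst; move: neqj neqk ltpi ltiq;
    do ?case: ifP; clear; lia.
- have ap : edge a p by rewrite edgeC.
  by case: (flip_third ltp ap pq) => ?; subst; move: neqj neqk ltpi ltiq;
    do ?case: ifP; clear; lia.
- by case: (flip_third lti pi iq) => ?; subst; move: neqj neqk ltpi ltiq;
    do ?case: ifP; clear; lia.
Qed.

(** This corner is again the middle corner of a new triangle. If it is [w], it is down and one of
    its arcs has grown; if it is [a] or [b], it is up and one of its arcs has shrunk. *)
Lemma flip_coord_gt : x (middle a w b) < coordz flip (middle a w b).
Proof.
have [neaw newb neba] := cyc_key_neq awb; have [nebz neza _] := cyc_key_neq bza.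
have /andP[wbz zaw] := cyc_quad awb bza.
have nezw : z != w by case: (cyc_key_neq zaw) => _ _; rewrite eq_sym.
have wz' := flip_new_edge; have zw' : is_edge flip z w by rewrite edgeC.
have wa : edge w a by rewrite edgeC.
have az : edge a z by rewrite edgeC.
have zb : edge z b by rewrite edgeC.
have bw : edge b w by rewrite edgeC.
have wba : cyc (key w) (key b) (key a) by rewrite -cyc_rot.
have baw : cyc (key b) (key a) (key w) by rewrite -cyc_rot.
have E' p q : (p < N)%N -> (q < N)%N -> edge p q ->
    ((p != a) && (p != b)) || ((q != a) && (q != b)) -> is_edge flip p q.
  move=> ltp ltq pq neq; apply: flip_edge => //; apply: contraL neq => /eqP[-> ->];
  by rewrite !eqxx ?andbF.
have xE := triangle_coord triT; have xE' := triangle_coord flip_triangulation_label.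
have newa : w != a by rewrite eq_sym.
have nezb : z != b by rewrite eq_sym.
have aw' : is_edge flip a w by apply: E' => //; rewrite newa newb orbT.
have wb' : is_edge flip w b by apply: E' => //; rewrite newa newb.
have bz' : is_edge flip b z by apply: E' => //; rewrite neza nezb orbT.
have za' : is_edge flip z a by apply: E' => //; rewrite neza nezb.
have wa' : is_edge flip w a by rewrite edgeC.
have bw' : is_edge flip b w by rewrite edgeC.
have zb' : is_edge flip z b by rewrite edgeC.
have az' : is_edge flip a z by rewrite edgeC.
rewrite /middle; case: (ltngtP a w) (neaw) => // [a_w|w_a] _;
  first case: (ltngtP w b) (newb) => // [w_b|b_w] _.
- have upw := middle_down ltb wba (introT andP (conj a_w w_b)).
  rewrite (xE a w b) ?a_w // upw.
  case: (ltngtP z w) (nezw) => // [z_w|w_z] _.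
    rewrite (xE' z w b) ?z_w // upw (bet_add ltz lta ltw zaw) ltz_nat ltn_pmul2r ?bet_gt0 //.
    by have := bet_gt0 ltz lta neza; clear; lia.
  rewrite (xE' a w z) ?a_w // upw (bet_add ltw ltb ltz wbz) ltz_nat ltn_pmul2l ?bet_gt0 //.
  by have := bet_gt0 ltb ltz nebz; clear; lia.
- have upb := middle_up ltw baw (introT andP (conj ltab b_w)).
  rewrite ltab (xE a b w) ?ltab // upb.
  have z_b : (z < b)%N.
    case: (ltngtP z b) (nebz) => // b_z _.
    by move: upb; rewrite (up_between ltab b_z ltz) (cyc_antir bza).
  rewrite (xE' z b w) ?z_b // upb (bet_add ltb ltz lta bza) ltrD2l ltrN2 ltz_nat.
  rewrite ltn_pmul2r ?bet_gt0 // 1?eq_sym //.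
  by have := bet_gt0 ltz lta neza; clear; lia.
- have upa := middle_up ltb awb (introT andP (conj w_a ltab)).
  rewrite ltab (xE w a b) ?w_a // upa.
  have a_z : (a < z)%N.
    case: (ltngtP a z) (neza) => // z_a _.
    have abz : cyc (key a) (key b) (key z) by rewrite cyc_rot.
    by move: upa; rewrite (up_between z_a ltab ltb) (cyc_antir abz).
  rewrite (xE' w a z) ?w_a // upa (bet_add ltb ltz lta bza) ltrD2l ltrN2 ltz_nat.
  rewrite ltn_pmul2l ?bet_gt0 // 1?eq_sym //.
  by have := bet_gt0 ltb ltz nebz; clear; lia.
Qed.

End Flip.
End Flux.

(* [w] and [z] are the third corners of the triangles of [T] below and above
   the diagonal [a b]. *)
Definition flippable T a b w z : Prop :=
  [/\ [/\ (a < b)%N, (b < N)%N, (w < N)%N & (z < N)%N],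
      cyc (key a) (key w) (key b) /\ cyc (key b) (key z) (key a), is_edge T a b &
      [/\ is_edge T a w, is_edge T w b, is_edge T b z & is_edge T z a]].

Lemma flippable_middle T a b w z : flippable T a b w z ->
  [/\ (0 < middle a w b <= n)%N, (0 < middle b z a <= n)%N,
      side a b (middle a w b) & side a b (middle b z a) = false].
Proof.
case=> -[ltab ltb ltw ltz] [awb bza] _ _; have lta := ltn_trans ltab ltb.
have [neaw newb neba] := cyc_key_neq awb; have [nebz neza neab] := cyc_key_neq bza.
have lej := middle_bounds lta ltw ltb neaw newb neba.
have lek := middle_bounds ltb ltz lta nebz neza neab.
split=> //; first exact: side_middle.
have ltk : (middle b z a < N)%N by move: lek; clear; lia.
by rewrite (sideC ltb lta ltk) ?side_middle // eq_sym.
Qed.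

(** Only the coordinates at the two middle corners change; the constant total makes the changes
    opposite, and [flip_coord_gt] gives the sign. *)
Lemma flip_effect T a b w z : T \in triangulations N -> flippable T a b w z ->
  exists2 d : int, 0 < d & forall p q,
    side_sum (coordz (flip T a b w z)) p q = side_sum (coordz T) p q +
      d *+ side p q (middle a w b) - d *+ side p q (middle b z a).
Proof.
move=> triT flp; have [lej lek sj sk] := flippable_middle flp.
case: (flp) => -[ltab ltb ltw ltz] [awb bza] ab [aw wb bz za].
set j := middle a w b in lej sj *; set k := middle b z a in lek sk *.
have nejk : j != k by apply: contraTneq sj => ->; rewrite sk.
set T' := flip T a b w z.
have triT' : T' \in triangulations N by apply: flip_triangulation_label.
pose d := coordz T' j - coordz T j; pose e := coordz T' k - coordz T k.
have eff i : (0 < i <= n)%N -> coordz T' i = coordz T i + d *+ (i == j) + e *+ (i == k).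
  move=> lei; have [->|neij] := eqVneq i j.
    by rewrite (negbTE nejk) /= mulr1n mulr0n /d; ring.
  have [->|neik] := eqVneq i k; first by rewrite /= mulr1n mulr0n /e; ring.
  by rewrite !addr0; apply: flip_coord_other.
have eNd : e = - d.
  have := coord_total triT'; rewrite -(coord_total triT).
  have -> : \sum_(i < n) coordz T' i.+1 = \sum_(i < n) coordz T i.+1 + (e + d).
    rewrite (addrC e) -{1}(sum_pick (fun _ => d) lej) -(sum_pick (fun _ => e) lek).
    rewrite addrA -!big_split /=; apply: eq_bigr => i _; rewrite eff //.
    by have := ltn_ord i; clear; lia.
  by rewrite !mulr2n; move: (\sum_(i < n) _) => S; clearbody d e; clear; lia.
exists d => [|p q].
  by rewrite /d subr_gt0; apply: flip_coord_gt.
rewrite /side_sum -(sum_pick (fun i => d *+ side p q i) lej).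
rewrite -(sum_pick (fun i => d *+ side p q i) lek) -big_split /= -sumrB.
apply: eq_bigr => i _; rewrite eff; last by have := ltn_ord i; clear; lia.
by rewrite eNd; case: (side _ _ _); case: (_ == _); case: (_ == _); rewrite ?mulr1n ?mulr0n; ring.
Qed.

(** * Flips that lower the sum over a side *)

Section Descent.

Variables (T : {set {set 'I_N}}) (p q : nat).
Hypothesis triT : T \in triangulations N.
Hypotheses (ltpq : (p < q)%N) (ltq : (q < N)%N).

Local Notation edge := (is_edge T).
Local Notation cyck a b c := (cyc (key a) (key b) (key c)).

Let ltp : (p < N)%N. Proof. exact: ltn_trans ltpq ltq. Qed.

(** By [flip_effect], such a flip moves a positive amount from a coordinate on the side of [p q] to
    one off it. *)
Definition descending : Prop := exists a b w z, flippable T a b w z /\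
  side p q (middle a w b) = false /\ side p q (middle b z a).

Let side_p : side p q p = up p.
Proof. by rewrite side_end_l ltpq. Qed.

Let side_q : side p q q = up q.
Proof. by rewrite side_end_r ltpq. Qed.

Let sideE i : i != p -> i != q -> side p q i = cyck p i q.
Proof. exact: side_inner. Qed.

(* [u l] crosses the chord [p q]; the triangle of [u l] towards [p] has its
   middle corner outside the side of [p q], and so has every further triangle
   towards [q], until the descent occurs. *)
Lemma walk_rising u l z : (u < N)%N -> (l < N)%N -> (z < N)%N ->
  cyck p l q -> cyck q u p -> (u < l)%N -> edge u l ->
  edge u z -> edge z l -> cyck u z l -> side p q (middle u z l) = false -> descending.
Proof.
have [m] := ubnP (bet l u); elim: m u l z => // m IHm u l z ltm.
move=> ltu ltl ltz plq qup ltul ul uz zl uzl sF.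
have lu : edge l u by rewrite edgeC.
have quad := cyc_quad plq qup; case/andP: quad => lqu upl.
have [w [ltw lwu lw wu]] := edge_triangle triT ltl ltu ltq lu lqu.
have [sT|sN] := boolP (side p q (middle l w u)).
  exists u, l, z, w; split=> //; split=> //.
have [nelw newu nelu] := cyc_key_neq lwu.
have newp : w != p.
  by apply/eqP => ewp; move: lwu upl; rewrite ewp /cyc; clear; lia.
have [neup nelp] : u != p /\ l != p.
  by split; [case: (cyc_key_neq qup)|rewrite eq_sym; case: (cyc_key_neq plq)].
have [neuq nelq] : u != q /\ l != q.
  by split; [rewrite eq_sym; case: (cyc_key_neq qup)|case: (cyc_key_neq plq)].
have sl : side p q l = true by rewrite sideE.
have su : side p q u = false.
  by rewrite sideE //; move: qup; rewrite /cyc; clear; lia.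
have addb := bet_add ltl ltw ltu lwu.
have ltul_lu : (l < u)%N = false by rewrite ltnNge ltnW.
(* The walk cannot reach [q] without a descent: this triangle would have its middle corner on the
   side of [p q], or the order [p < q < u < l] would contradict the cyclic order. *)
have [ewq|newq] := eqVneq w q.
  exfalso; move: sN lwu; rewrite ewq /middle ltul_lu => + lqu'.
  case: (ltngtP l q) nelq => // [l_q|q_l] _.
    by rewrite ltnNge (ltnW (ltn_trans ltul l_q)) /= sl.
  case: (ltngtP q u) neuq => // [q_u|u_q] _.
    have upu := up_between q_u ltul ltl; have := up_between (ltn_trans ltpq q_u) ltul ltl.
    by move: upu upl lqu; rewrite /cyc; clear; lia.
  have upq := up_between u_q q_l ltl.
  by rewrite side_q upq; move: lqu; rewrite /cyc; clear; lia.
(* The corner [w] replaces the end of [u l] on its own side of the chord [p q], so the new edge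
   crosses [p q] again, closer to [q]. *)
have [pwq|npwq] := boolP (cyck p w q).
  apply: (IHm u w l) => //; try by rewrite 1?edgeC.
  - by have := bet_gt0 ltl ltw nelw; move: addb ltm; clear; lia.
  - case: (ltngtP u w) newu => // w_u _; exfalso.
    have upu := up_between w_u ltul ltl.
    have : up u = false by rewrite upu; move: lwu; rewrite /cyc; clear; lia.
    have [q_u|leuq] := ltnP q u.
      rewrite (up_between (ltn_trans ltpq q_u) ltul ltl) => upF.
      by move: upF upl; rewrite /cyc; clear; lia.
    have u_q : (u < q)%N by rewrite ltn_neqAle neuq.
    rewrite (up_between w_u u_q ltq) => upF.
    by move: upF pwq qup; rewrite /cyc; clear; lia.
  - by rewrite -cyc_rot -cyc_rot.
  - by rewrite middle_rot ?(negbTE sN).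
have qwp : cyck q w p.
  have := npwq; have := cyc_keyN ltp ltw ltq; rewrite eq_sym newp newq => -> //.
  by rewrite neq_ltn ltpq orbT.
apply: (IHm w l u) => //; try by rewrite 1?edgeC.
- by have := bet_gt0 ltw ltu newu; move: addb ltm; clear; lia.
- case: (ltngtP w l) nelw => // l_w _; exfalso.
  by move: sN; rewrite /middle ltul_lu l_w ltnNge (ltnW (ltn_trans ltul l_w)) /= sl.
- by rewrite -cyc_rot.
- by rewrite -middle_rot ?(negbTE sN).
Qed.
(* As [walk_rising], but here all the triangles have their middle corner on the side
   of [p q]. *)
Lemma walk_falling u l z : (u < N)%N -> (l < N)%N -> (z < N)%N ->
  cyck p l q -> cyck q u p -> (l < u)%N -> edge u l ->
  edge u z -> edge z l -> cyck u z l -> side p q (middle u z l) -> descending.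
Proof.
have [m] := ubnP (bet l u); elim: m u l z => // m IHm u l z ltm.
move=> ltu ltl ltz plq qup ltul ul uz zl uzl sF.
have lu : edge l u by rewrite edgeC.
have quad := cyc_quad plq qup; case/andP: quad => lqu upl.
have [w [ltw lwu lw wu]] := edge_triangle triT ltl ltu ltq lu lqu.
have [sT|sN] := boolP (side p q (middle l w u)); last first.
  by exists l, u, w, z; rewrite (negbTE sN); split=> //; split=> //.
have [nelw newu nelu] := cyc_key_neq lwu.
have newp : w != p.
  by apply/eqP => ewp; move: lwu upl; rewrite ewp /cyc; clear; lia.
have [neup nelp] : u != p /\ l != p.
  by split; [case: (cyc_key_neq qup)|rewrite eq_sym; case: (cyc_key_neq plq)].
have [neuq nelq] : u != q /\ l != q.
  by split; [rewrite eq_sym; case: (cyc_key_neq qup)|case: (cyc_key_neq plq)].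
have sl : side p q l = true by rewrite sideE.
have su : side p q u = false.
  by rewrite sideE //; move: qup; rewrite /cyc; clear; lia.
have addb := bet_add ltl ltw ltu lwu.
have [ewq|newq] := eqVneq w q.
  exfalso; move: sT lwu; rewrite ewq /middle ltul => + lqu'.
  case: (ltngtP q u) neuq => // [q_u|u_q] _; last first.
    by rewrite (ltn_trans ltul u_q) su.
  case: (ltngtP l q) nelq => // [l_q|q_l] _.
    rewrite side_q (up_between l_q q_u ltu).
    by move: lqu; rewrite /cyc; clear; lia.
  have := up_between q_l ltul ltu; have := up_between (ltn_trans ltpq q_l) ltul ltu.
  by move: upl lqu; rewrite /cyc; clear; lia.
have [pwq|npwq] := boolP (cyck p w q).
  apply: (IHm u w l) => //; try by rewrite 1?edgeC.
  - by have := bet_gt0 ltl ltw nelw; move: addb ltm; clear; lia.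
  - case: (ltngtP w u) newu => // u_w _; exfalso.
    by move: sT; rewrite /middle ltul (ltn_trans ltul u_w) (leq_gtF (ltnW u_w)) su.
  - by rewrite -cyc_rot -cyc_rot.
  - by rewrite middle_rot.
have qwp : cyck q w p.
  have := npwq; have := cyc_keyN ltp ltw ltq; rewrite eq_sym newp newq => -> //.
  by rewrite neq_ltn ltpq orbT.
apply: (IHm w l u) => //; try by rewrite 1?edgeC.
- by have := bet_gt0 ltw ltu newu; move: addb ltm; clear; lia.
- case: (ltngtP l w) nelw => // w_l _; exfalso.
  have upl' : up l by rewrite (up_between w_l ltul ltu).
  have [p_l|lelp] := ltnP p l.
    move: upl'; rewrite (up_between p_l ltul ltu).
    by move: upl; rewrite /cyc; clear; lia.
  have l_q : (l < q)%N by apply: leq_ltn_trans ltpq.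
  move: upl'; rewrite (up_between w_l l_q ltq).
  by move: plq qwp; rewrite /cyc; clear; lia.
- by rewrite -cyc_rot.
- by rewrite -middle_rot.
Qed.

(** Turning around [p] gives a triangle whose opposite edge [l u] crosses [p q]. The order of [u]
    and [l] selects the walk, and this first triangle has its middle corner where that walk requires
    it. *)
Lemma descent : ~~ edge p q -> descending.
Proof.
move=> npq; have [s [lts /(_ T) ps _ succ_s]] := label_succ ltp.
have nesq : s != q by apply: contraNneq npq => <-.
have neps := edge_neq triT ps.
have neqp : q != p by rewrite neq_ltn ltpq orbT.
have psq : cyck p s q.
  rewrite -[cyc _ _ _]negbK -cyc_keyN //; apply: contra (succ_s q ltq).
  by rewrite -cyc_rot.
have [|l [u [ltl ltu plq npuq [lup pl pu lu]]]] :=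
  @edge_fan T triT (fun x => cyck p x q) p s ltp lts ps psq.
  by move=> x ltx _ pxq; exists q; rewrite -cyc_rot.
have neuq : u != q by apply: contraNneq npq => <-.
have nepu := edge_neq triT pu.
have qup : cyck q u p by rewrite cyc_keyN.
have ul : edge u l by rewrite edgeC.
have up' : edge u p by rewrite edgeC.
have upl : cyck u p l by rewrite -cyc_rot.
have [_ nelu _] := cyc_key_neq lup.
have nelp : l != p by rewrite eq_sym; case: (cyc_key_neq plq).
have nelq : l != q by case: (cyc_key_neq plq).
have neup : u != p by rewrite eq_sym.
have sl : side p q l = true by rewrite sideE.
have su : side p q u = false by rewrite sideE //; apply/negbTE.
case: (ltngtP u l) (edge_neq triT ul) => // [u_l|l_u] _.
  apply: (@walk_rising u l p) => //; rewrite /middle.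
  case: (ltngtP u p) neup => // [u_p|p_u] _; last by rewrite u_l su.
  case: (ltngtP p l) nelp => // [p_l|l_p] _.
    rewrite side_p (up_between u_p p_l ltl).
    by move: plq qup; rewrite /cyc; clear; lia.
  have := up_between u_l l_p ltp; have := up_between u_l (ltn_trans l_p ltpq) ltq.
  by move: plq qup; rewrite u_l /cyc; clear; lia.
apply: (@walk_falling u l p) => //; rewrite /middle.
case: (ltngtP u p) neup => // [u_p|p_u] _.
  have := up_between l_u u_p ltp; have := up_between l_u (ltn_trans u_p ltpq) ltq.
  by move: plq qup; rewrite /cyc; clear; lia.
have -> : (u < l)%N = false by rewrite ltnNge ltnW.
case: (ltngtP p l) nelp => // l_p _.
rewrite side_p (up_between l_p p_u ltu).
by move: plq qup; rewrite /cyc; clear; lia.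
Qed.

End Descent.

(* Twice the excess of the sum of the coordinates below [p q] over its minimum. *)
Definition slack T p q : int := side_sum (coordz T) p q *+ 2 - side_value p q.

Lemma triangulation_exists : exists T, T \in triangulations N.
Proof.
have [|T triT _] := @noncrossing_extend N N_ge3 set0; last by exists T.
by apply/(noncrossing_setsP N_ge3); split; [exact: sub0set|move=> ? ? ? ?; rewrite inE].
Qed.

(* A triangulation of minimal slack contains [p q], as otherwise a flip lowers
   the slack further; so the minimum is [0] and is only attained there. *)
Lemma slack_ge0 T p q : T \in triangulations N -> (p < q)%N -> (q < N)%N ->
  (0 <= slack T p q) && ((slack T p q == 0) == is_edge T p q).
Proof.
move=> triT ltpq ltq; have ltp := ltn_trans ltpq ltq.
have flipP S : S \in triangulations N -> ~~ is_edge S p q ->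
    exists2 S', S' \in triangulations N & slack S' p q < slack S p q.
  move=> triS npq; have [a [b [w [z [flp [sj sk]]]]]] := descent triS ltpq ltq npq.
  have [d lt0d eff] := flip_effect triS flp; exists (flip S a b w z).
    case: flp => -[ltab ltb ltw ltz] [awb bza] ab [aw wb bz za].
    exact: flip_triangulation_label.
  rewrite /slack eff sj sk mulr0n mulr1n addr0 ltrD2r.
  by move: (side_sum _ _ _) lt0d => S0; clear; rewrite !mulr2n; lia.
have edge0 S : S \in triangulations N -> is_edge S p q -> slack S p q = 0.
  by move=> triS pq; rewrite /slack side_sum_edge // subrr.
have min_ge0 : forall S, S \in triangulations N -> 0 <= slack S p q.
  have [S0 triS0 minS0] := @arg_minP _ int _ T (mem (triangulations N)) (fun S => slack S p q) triT.
  have S0pq : is_edge S0 p q.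
    have [//|npq] := boolP (is_edge S0 p q).
    have [S1 triS1] := flipP _ triS0 npq; have := minS0 _ triS1.
    by move=> le lt; have := le_lt_trans le lt; rewrite ltxx.
  by move=> S triS; rewrite -(edge0 _ triS0 S0pq) minS0.
rewrite min_ge0 //=; have [pq|npq] := boolP (is_edge T p q); first by rewrite edge0 // eqxx.
have [S triS lt] := flipP _ triT npq; apply/eqP/negbTE; rewrite gt_eqF //.
exact: le_lt_trans (min_ge0 _ triS) lt.
Qed.

End Labels.
(** * The face lattice of the convex hull *)

From mathcomp Require Import classical_sets boolp functions cardinality.
From mathcomp Require Import reals convex interval_inference.

Local Open Scope classical_set_scope.
Local Open Scope ring_scope.

Section ConvexHull.

Variables (R : realType) (m : nat).
Implicit Types (S : set 'rV[R]_m) (c : 'cV[R]_m).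

Lemma sub_convex_hull S : S `<=` convex_hull S.
Proof. exact: sub_gen_smallest. Qed.

Lemma convex_hull_sub S (Q : set 'rV[R]_m) :
  (forall x y t, Q x -> Q y -> 0 <= t -> t <= 1 -> Q (t *: x + (1 - t) *: y)) ->
  S `<=` Q -> convex_hull S `<=` Q.
Proof.
move=> convQ subS; apply: smallest_sub => // x y t.
by rewrite !inE => Qx Qy; apply: (convQ x y t%:num).
Qed.

Lemma convex_hull_le S c b : (forall x, S x -> (x *m c) 0 0 <= b) ->
  forall x, convex_hull S x -> (x *m c) 0 0 <= b.
Proof.
move=> Sb; apply: (@convex_hull_sub S (fun x => (x *m c) 0 0 <= b)) => // x y t cx cy t0 t1.
rewrite mulmxDl -!scalemxAl !mxE; move: cx cy; rewrite !mxE; set X := \sum_j _; set Y := \sum_j _.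
by move=> cx cy; nra.
Qed.

Lemma convex_hull_lt S c b : (forall x, S x -> (x *m c) 0 0 < b) ->
  forall x, convex_hull S x -> (x *m c) 0 0 < b.
Proof.
move=> Sb; apply: (@convex_hull_sub S (fun x => (x *m c) 0 0 < b)) => // x y t cx cy t0 t1.
rewrite mulmxDl -!scalemxAl !mxE; move: cx cy; rewrite !mxE; set X := \sum_j _; set Y := \sum_j _.
move=> cx cy; have [->|t_neq0] := eqVneq t 0; first by lra.
have t_gt0 : 0 < t by rewrite lt_neqAle eq_sym t_neq0.
by nra.
Qed.

End ConvexHull.

Section Realization.

Variables (R : realType) (n : nat) (A : rel 'I_n.-1).
Hypothesis n_ge2 : (2 <= n)%N.

Local Notation N := n.+2.
Local Notation tri := (triangulations N).
Local Notation vertex := (@vertex n A).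
Local Notation M := (@M n A R).
Local Notation Q := (convex_hull [set M T | T in [set` tri]]).

Implicit Types (T S : {set {set 'I_N}}) (D E : {set 'I_N}).

Let N_ge3 : (3 <= N)%N. Proof. by lia. Qed.

Lemma M_coordz T (i : 'I_n) : M T 0 i = (coordz A T i.+1)%:~R.
Proof. by rewrite mxE /coordz; case: ifP => _ //; rewrite rmorphB. Qed.

Lemma diagonal_labels D : D \in diagonals N ->
  exists x : 'I_N * 'I_N, (x.1 < x.2)%N && (D == [set vertex x.1; vertex x.2]%SET).
Proof.
case/(polygon_diagonalP N_ge3) => -[u v] /= -> /andP[ltuv _].
have [a lta eu] := vertex_surj A n_ge2 u; have [b ltb ev] := vertex_surj A n_ge2 v.
have [ltab|ltba|eab] := ltngtP a b; last by rewrite eu ev eab ltnn in ltuv.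
  by exists (Ordinal lta, Ordinal ltb); rewrite /= ltab -eu -ev eqxx.
by exists (Ordinal ltb, Ordinal lta); rewrite /= ltba finset.setUC -eu -ev eqxx.
Qed.

Definition ends D : 'I_N * 'I_N :=
  odflt (ord0, ord0) [pick x : 'I_N * 'I_N |
    (x.1 < x.2)%N && (D == [set vertex x.1; vertex x.2]%SET)].

Lemma endsP D : D \in diagonals N ->
  ((ends D).1 < (ends D).2)%N /\ D = [set vertex (ends D).1; vertex (ends D).2]%SET.
Proof.
move/diagonal_labels=> [x xP]; rewrite /ends; case: pickP => [y /andP[? /eqP ?] //|/(_ x)].
by rewrite xP.
Qed.

(** * The inequality of a diagonal *)

Definition facet D : 'cV[R]_n := \col_i (side A (ends D).1 (ends D).2 i.+1)%:R.

Definition level D : R := (side_value A (ends D).1 (ends D).2)%:~R / 2.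

Definition gap D (x : 'rV[R]_n) : R := (x *m facet D) 0 0 - level D.

Lemma gap_M T D : gap D (M T) = (slack A T (ends D).1 (ends D).2)%:~R / 2.
Proof.
rewrite /gap /level /slack rmorphB /= mulrBl; congr (_ - _).
rewrite rmorphMn /= -mulr_natr mulfK ?pnatr_eq0 // mxE /side_sum rmorph_sum /=.
by apply: eq_bigr => i _; rewrite M_coordz mxE rmorphMn /= mulr_natr.
Qed.

Lemma gap_M_edge T D : T \in tri -> D \in diagonals N ->
  0 <= gap D (M T) /\ (gap D (M T) == 0) = (D \in T).
Proof.
move=> triT diagD; have [lt_ends eD] := endsP diagD; rewrite gap_M.
have /andP[ge0 /eqP eq0] := slack_ge0 A n_ge2 triT lt_ends (ltn_ord _).
split; first by rewrite divr_ge0 ?ler0z.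
rewrite mulf_eq0 invr_eq0 pnatr_eq0 orbF intr_eq0 eq0 /is_edge -eD finset.in_setU.
by move: diagD; rewrite inE => /andP[_ /negbTE->]; rewrite orbF.
Qed.

Lemma gapB D x y : gap D x - gap D y = ((x - y) *m facet D) 0 0.
Proof. by rewrite /gap mulmxBl !mxE; ring. Qed.

Lemma tri_diagonal T D : T \in tri -> D \in T -> D \in diagonals N.
Proof. by rewrite inE => /andP[/(noncrossing_setsP N_ge3)[/fintype.subsetP subT _] _] /subT. Qed.

Lemma M_hull T : T \in tri -> Q (M T).
Proof. by move=> triT; apply: sub_convex_hull; exists T. Qed.

Lemma gap_hull_ge0 D x : D \in diagonals N -> Q x -> 0 <= gap D x.
Proof.
move=> diagD Qx; rewrite subr_ge0 -lerN2.
have -> : - (x *m facet D) 0 0 = (x *m - facet D) 0 0 by rewrite mulmxN !mxE.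
apply: convex_hull_le Qx => _ [T triT <-]; rewrite mulmxN mxE lerN2 -subr_ge0.
by case: (gap_M_edge triT diagD).
Qed.

(** * The flip directions at a vertex *)

Let ones : 'cV[R]_n := const_mx 1.

Lemma M_ones T S : T \in tri -> S \in tri -> ((M T - M S) *m ones) 0 0 = 0.
Proof.
have tot U : U \in tri -> (M U *m ones) 0 0 = ((n%:Z * (n%:Z + 1))%:~R) / 2 :> R.
  move=> triU; rewrite -(coord_total A n_ge2 triU) rmorphMn /= -mulr_natr mulfK ?pnatr_eq0 //.
  by rewrite mxE rmorph_sum /=; apply: eq_bigr => i _; rewrite M_coordz mxE mulr1.
move=> triT triS; have -> : ((M T - M S) *m ones) 0 0 = (M T *m ones) 0 0 - (M S *m ones) 0 0.
  by rewrite mulmxBl !mxE.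
by rewrite !tot // subrr.
Qed.

Definition flip_of T D : {set {set 'I_N}} :=
  odflt T [pick T' in tri | (T :\ D \subset T')%SET && (D \notin T')].

Lemma flip_ofP T D : T \in tri -> D \in T ->
  [/\ flip_of T D \in tri, (T :\ D \subset flip_of T D)%SET & D \notin flip_of T D].
Proof.
move=> triT DT; have [T' triT' T'P] := flip_exists N_ge3 triT DT.
by rewrite /flip_of; case: pickP => [S /andP[? /andP[? ?]] //|/(_ T')]; rewrite triT' T'P.
Qed.

Definition ray T D : 'rV[R]_n := M (flip_of T D) - M T.

Lemma gap_M_eq0 T D : T \in tri -> D \in T -> gap D (M T) = 0.
Proof.
move=> triT DT; have [_] := gap_M_edge triT (tri_diagonal triT DT).
by rewrite DT => /eqP.
Qed.

Lemma gap_ray T D E : T \in tri -> D \in T -> E \in T ->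
  (ray T D *m facet E) 0 0 = gap E (M (flip_of T D)).
Proof.
by move=> triT DT ET; rewrite -gapB (gap_M_eq0 triT ET) subr0.
Qed.

Lemma ray_facet_gt0 T D : T \in tri -> D \in T -> 0 < (ray T D *m facet D) 0 0.
Proof.
move=> triT DT; have [triT' _ DT'] := flip_ofP triT DT; rewrite gap_ray //.
have [ge0 eq0] := gap_M_edge triT' (tri_diagonal triT DT).
by rewrite lt_neqAle ge0 andbT eq_sym eq0.
Qed.

(** Flipping [D] keeps [E], so the gap of [E] stays [0]. With [ray_facet_gt0], the rays are dual to
    the facet normals up to positive factors. *)
Lemma ray_facet_eq0 T D E : T \in tri -> D \in T -> E \in T -> E != D ->
  (ray T D *m facet E) 0 0 = 0.
Proof.
move=> triT DT ET neED; have [triT' subT' _] := flip_ofP triT DT; rewrite gap_ray //.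
have [_ eq0] := gap_M_edge triT' (tri_diagonal triT ET).
by apply/eqP; rewrite eq0 (fintype.subsetP subT') // in_setD1 neED.
Qed.

Definition rays T : #|T|.-tuple 'rV[R]_n := [tuple ray T (enum_val i) | i < #|T|].

Lemma nth_rays T (i : 'I_#|T|) : (rays T)`_i = ray T (enum_val i).
Proof. by rewrite -tnth_nth tnth_mktuple. Qed.

Lemma rays_facet T (k : 'I_#|T| -> R) (i : 'I_#|T|) : T \in tri ->
  ((\sum_j k j *: (rays T)`_j) *m facet (enum_val i)) 0 0 =
    k i * (ray T (enum_val i) *m facet (enum_val i)) 0 0.
Proof.
move=> triT; rewrite mulmx_suml summxE (bigD1 i) //= -scalemxAl mxE nth_rays.
rewrite big1 ?addr0 // => j neji; rewrite -scalemxAl mxE nth_rays.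
rewrite ray_facet_eq0 ?enum_valP ?mulr0 //.
by rewrite (inj_eq enum_val_inj) eq_sym.
Qed.

Lemma rays_free T : T \in tri -> free (rays T).
Proof.
move=> triT; apply/freeP => k sum0 i.
have := rays_facet k i triT; rewrite sum0 mul0mx mxE => /esym/eqP.
rewrite mulf_eq0 => /orP[/eqP//|].
by rewrite gt_eqF // ray_facet_gt0 ?enum_valP.
Qed.

Lemma card_tri T : T \in tri -> #|T| = n.-1.
Proof. by rewrite inE => /andP[_ /eqP->]; lia. Qed.

Lemma dim_rays T : T \in tri -> \dim <<rays T>> = n.-1.
Proof. by move=> triT; move/eqP: (rays_free triT) => ->; rewrite size_tuple card_tri. Qed.

Let total : 'Hom('rV[R]_n, 'M[R]_1) := linfun (mulmxr ones).

Lemma total_ker (y : 'rV[R]_n) : (y \in lker total) = ((y *m ones) 0 0 == 0).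
Proof.
rewrite memv_ker lfunE /=; apply/eqP/eqP => [->|y0]; first by rewrite mxE.
by apply/matrixP => i j; rewrite !ord1 y0 mxE.
Qed.

(** All vertices have the same total, so the rays lie in the kernel; the form [total] is nonzero at
    the all-ones vector, so its kernel has dimension [n - 1], the number of free rays. *)
Lemma rays_span T : T \in tri -> <<rays T>>%VS = lker total.
Proof.
move=> triT; apply/eqP; rewrite eqEdim; apply/andP; split.
  apply/span_subvP => y /(nthP 0)[i]; rewrite size_tuple => lti <-.
  have -> : (rays T)`_i = ray T (enum_val (Ordinal lti)) by rewrite -(nth_rays (Ordinal lti)).
  have [triT' _ _] := flip_ofP triT (enum_valP (Ordinal lti)).
  by rewrite total_ker M_ones.
rewrite dim_rays // -ltnS prednK; last by lia.
have := limg_ker_dim total fullv; rewrite capfv dimvf dim_matrix mul1r => dimE.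
suff : (0 < \dim (limg total))%N by move: dimE; clear; lia.
rewrite lt0n dimv_eq0; apply/negP => /eqP img0.
have : total (const_mx 1) \in limg total by rewrite memv_img ?memvf.
rewrite img0 memv0 lfunE /= => /eqP/matrixP/(_ 0 0); rewrite !mxE => /eqP.
rewrite (eq_bigr (fun=> 1)) => [|i _]; last by rewrite !mxE mulr1.
by rewrite sumr_const card_ord pnatr_eq0; move: n_ge2; clear; lia.
Qed.

Lemma hull_span T x : T \in tri -> Q x -> x - M T \in <<rays T>>%VS.
Proof.
move=> triT Qx; rewrite rays_span // total_ker mulmxBl mxE [X in _ + X]mxE subr_eq0 eq_le.
have M_tot S : S \in tri -> (M S *m ones) 0 0 = (M T *m ones) 0 0.
  move=> triS; apply/eqP; rewrite -subr_eq0; have := M_ones triS triT.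
  by rewrite mulmxBl mxE [X in _ + X]mxE => ->.
apply/andP; split; first by apply: convex_hull_le Qx => _ [S triS <-]; rewrite M_tot.
rewrite -lerN2; have negE y : - (y *m ones) 0 0 = (y *m - ones) 0 0.
  by rewrite mulmxN [RHS]mxE.
rewrite !negE; apply: convex_hull_le Qx => _ [S triS <-].
by rewrite -!negE M_tot.
Qed.

(* At the vertex [M T] the polytope is contained in the simplicial cone spanned
   by the flips of [T], whose coordinates are the positive multiples of the gaps
   of the diagonals of [T]. *)
Lemma hull_cone T x : T \in tri -> Q x -> exists2 k : {set 'I_N} -> R,
  x = M T + \sum_(D in T) k D *: ray T D &
  forall D, D \in T -> 0 <= k D /\ (k D == 0) = (gap D x == 0).
Proof.
move=> triT Qx; have xT := hull_span triT Qx; have coordE := coord_span xT.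
(* By duality, the normal of [D] isolates the coefficient of the ray of [D]. *)
pose k D := gap D x / (ray T D *m facet D) 0 0.
have kE i : coord (rays T) i (x - M T) = k (enum_val i).
  have Ei := enum_valP i.
  have := rays_facet (fun i => coord (rays T) i (x - M T)) i triT.
  rewrite -coordE -gapB (gap_M_eq0 triT Ei) subr0 /k => ->; rewrite mulfK //.
  by rewrite gt_eqF ?ray_facet_gt0.
exists k => [|D DT].
  apply/eqP; rewrite addrC -subr_eq {1}coordE; apply/eqP.
  rewrite [RHS]big_enum_val; apply: eq_bigr => i _.
  by rewrite kE nth_rays.
have gt0 := ray_facet_gt0 triT DT; have diagD := tri_diagonal triT DT.
rewrite /k divr_ge0 ?(ltW gt0) ?gap_hull_ge0 //.
by rewrite mulf_eq0 invr_eq0 (gt_eqF gt0) orbF.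
Qed.

(** * Faces and non-crossing sets *)

Definition face S : set 'rV[R]_n :=
  Q `&` [set x | forall D, D \in S -> gap D x = 0].

(** Add up the inequalities of the diagonals in [S]: a sum of nonnegative gaps vanishes only if each
    gap does. *)
Lemma face_is_face S : (S \subset diagonals N)%SET -> is_face Q (face S).
Proof.
move=> /fintype.subsetP diagS.
exists (- \sum_(D in S) facet D), (- \sum_(D in S) level D).
have sumE x : (x *m - \sum_(D in S) facet D) 0 0 =
    - \sum_(D in S) level D - \sum_(D in S) gap D x.
  rewrite mulmxN mxE mulmx_sumr summxE -opprD -big_split /=; congr (- _).
  by apply: eq_bigr => D _; rewrite /gap addrC subrK.
split=> [x Qx|].
  rewrite sumE lerBlDr lerDl sumr_ge0 // => D DS.
  by apply: gap_hull_ge0 (diagS _ DS) Qx.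
apply/seteqP; split=> x [Qx Px]; split=> //=.
  by rewrite sumE [X in _ - X]big1 ?subr0 // => D DS; apply: Px.
move=> D DS; move: Px; rewrite /= sumE => /eqP; rewrite -subr_eq0 addrAC subrr add0r oppr_eq0.
rewrite psumr_eq0 => [/allP/(_ D)|E ES]; last exact: gap_hull_ge0 (diagS _ ES) Qx.
by rewrite mem_index_enum DS => /(_ isT)/eqP.
Qed.

Lemma face_M T S : T \in tri -> (S \subset diagonals N)%SET ->
  face S (M T) <-> (S \subset T)%SET.
Proof.
move=> triT /fintype.subsetP diagS; split=> [[_ gap0]|/fintype.subsetP subST].
  apply/fintype.subsetP => D DS; have [_ <-] := gap_M_edge triT (diagS _ DS).
  by rewrite gap0.
split=> [|D DS]; first exact: M_hull.
by apply/eqP; have [_ ->] := gap_M_edge triT (diagS _ DS); apply: subST.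
Qed.

(** The form reaches [b] at some vertex [M T], as otherwise it would stay strictly smaller on the
    hull. It increases along no ray at [M T], so by [hull_cone] a point is maximal iff its
    coefficients vanish on the rays along which the form drops; [S] collects their diagonals. *)
Lemma is_face_face F : nonempty_faces Q F ->
  exists2 S, S \in noncrossing_sets N & F = face S.
Proof.
case=> -[c [b [Qb eF]]] [x0 Fx0].
have [T triT cT] : exists2 T, T \in tri & (M T *m c) 0 0 = b.
  apply: contrapT => noT; move: Fx0; rewrite eF => -[Qx0 /= /eqP].
  apply/negP; rewrite lt_eqF //; apply: convex_hull_lt Qx0 => _ [T triT <-].
  have := Qb _ (M_hull triT); rewrite le_eqVlt => /orP[/eqP cT|//].
  by case: noT; exists T.
pose S := [set D in T | (ray T D *m c) 0 0 != 0]%SET.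
have ray_le0 D : D \in T -> (ray T D *m c) 0 0 <= 0.
  move=> DT; have [triT' _ _] := flip_ofP triT DT.
  rewrite /ray mulmxBl mxE [X in _ + X]mxE cT subr_le0.
  exact: Qb _ (M_hull triT').
exists S.
  apply: (noncrossing_sub N_ge3 (T := T)); first by case/triangulation_maximal: triT.
  by apply/fintype.subsetP => D; rewrite inE => /andP[].
have cE x : Q x -> ((x *m c) 0 0 == b) = [forall D in S, gap D x == 0].
  move=> Qx; have [k eqx kP] := hull_cone triT Qx; rewrite {1}eqx.
  have -> : ((M T + \sum_(D in T) k D *: ray T D) *m c) 0 0 =
      b - \sum_(D in T) k D * - (ray T D *m c) 0 0.
    rewrite mulmxDl mxE cT mulmx_suml summxE -sumrN; congr (_ + _).
    by apply: eq_bigr => D _; rewrite -scalemxAl mxE mulrN opprK.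
  rewrite -subr_eq0 addrAC subrr add0r oppr_eq0 psumr_eq0 => [|D DT]; last first.
    by rewrite mulr_ge0 ?oppr_ge0 ?ray_le0 //; case: (kP D DT).
  apply/allP/forall_inP => [k0 D|gap0 D _].
    rewrite inE => /andP[DT neq0]; have := k0 D (mem_index_enum D).
    by rewrite DT mulf_eq0 oppr_eq0 (negbTE neq0) orbF; case: (kP D DT) => _ ->.
  apply/implyP => DT; rewrite mulf_eq0 oppr_eq0.
  have [_|neq0] := eqVneq ((ray T D *m c) 0 0) 0; first by rewrite orbT.
  by case: (kP D DT) => _ ->; rewrite gap0 // inE DT.
rewrite eF; apply/seteqP; split=> x [Qx Px]; split=> //=.
  move=> D DS; apply/eqP; move/eqP: Px; rewrite cE // => /forall_inP; exact.
by apply/eqP; rewrite cE //; apply/forall_inP => D DS; apply/eqP/Px.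
Qed.

Definition face_diagonals (F : set 'rV[R]_n) : {set {set 'I_N}} :=
  [set D in diagonals N | `[< forall x, F x -> gap D x = 0 >]]%SET.

(** Suppose the gap of some [D] outside [S] vanishes on the face. A triangulation [T] containing [S]
    then contains [D], but flipping [D] in [T] gives a vertex of the same face where this gap is
    positive. *)
Lemma face_diagonalsK S : S \in noncrossing_sets N -> face_diagonals (face S) = S.
Proof.
move=> ncS; have [diagS _] := noncrossing_setsP N_ge3 _ ncS.
apply/setP => D; rewrite inE; apply/andP/idP => [[diagD /asboolP gap0]|DS]; last first.
  split; first exact: (fintype.subsetP diagS).
  by apply/asboolP => x [_ /(_ D DS)].
apply: contrapT => /negP DS; have [T triT subST] := noncrossing_extend N_ge3 ncS.
have DT : D \in T.
  have [_ <-] := gap_M_edge triT diagD; apply/eqP/gap0.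
  exact/(face_M triT diagS).
have [triT' subT' /negP[]] := flip_ofP triT DT.
have [_ <-] := gap_M_edge triT' diagD; apply/eqP/gap0.
apply/(face_M triT' diagS)/fintype.subsetP => E ES; apply: (fintype.subsetP subT').
rewrite in_setD1 (fintype.subsetP subST) // andbT.
by apply: contra DS => /eqP <-.
Qed.

Lemma face_nonempty S : S \in noncrossing_sets N -> nonempty_faces Q (face S).
Proof.
move=> ncS; have [diagS _] := noncrossing_setsP N_ge3 _ ncS.
split; first exact: face_is_face.
by have [T triT subST] := noncrossing_extend N_ge3 ncS; exists (M T); apply/face_M.
Qed.

Lemma hull_associahedron : realizes_associahedron n Q.
Proof.
split.
- by exists [set M T | T in [set` tri]] => //; apply/finite_image/finite_finset.
- have [T triT] := triangulation_exists n_ge2.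
  exists (M T); first exact: M_hull.
  exists <<rays T>>%VS; first exact: dim_rays.
  split=> [x|W subW]; first exact: hull_span.
  apply/span_subvP => y /(nthP 0)[i]; rewrite size_tuple => lti <-.
  have -> : (rays T)`_i = ray T (enum_val (Ordinal lti)) by rewrite -(nth_rays (Ordinal lti)).
  have [triT' _ _] := flip_ofP triT (enum_valP (Ordinal lti)).
  exact: subW _ (M_hull triT').
- exists face_diagonals.
    split.
    + by move=> F /is_face_face[S ncS ->]; rewrite /= face_diagonalsK.
    + move=> F G; rewrite !inE => /is_face_face[S ncS ->] /is_face_face[S' ncS' ->].
      by rewrite !face_diagonalsK // => ->.
    + by move=> S ncS; exists (face S); [exact: face_nonempty|exact: face_diagonalsK].
  move=> F G /is_face_face[S ncS ->] /is_face_face[S' ncS' ->].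
  split=> [subF|]; last first.
    rewrite !face_diagonalsK // => /fintype.subsetP subS x [Qx gap0]; split=> // D /subS.
    exact: gap0.
  apply/fintype.subsetP => D; rewrite !inE => /andP[-> /asboolP gap0].
  by apply/asboolP => x /subF/gap0.
Qed.

End Realization.

Theorem theorem1p1 (R : realType) (n : nat) (A : rel 'I_n.-1) :
  (2 <= n)%N -> orientation (@coxeter_A n) A ->
  realizes_associahedron n
    (convex_hull [set M A R T | T in [set` triangulations n.+2]]) /\
  (forall T, T \in triangulations n.+2 ->
     forall i : 'I_n, M A R T 0 i \is a Num.int).
Proof.
move=> n_ge2 _; split; first exact: hull_associahedron.
by move=> T _ i; rewrite M_coordz intr_int.
Qed.
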